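(* Let $D\in\mathbb{N}$ and let $T:\mathbb{T}^D\times[0,1]\to\mathbb{T}^D\times[0,1]$ belong to the class $\mathcal{T}^*$. Let $\varphi^+$ be the upper bounding graph of $T$ and $\mu_{\varphi^+}$ its associated invariant measure. Then $\mu_{\varphi^+}$ is $D$-rectifiable, it is exact dimensional and its information dimension exists, and $$d_{\mu_{\varphi^+}}=D_1(\mu_{\varphi^+})=D.$$
   Context: Notation: $\mathbb{N}=\{1,2,\dots\}$; $\mathbb{T}^D=\mathbb{R}^D/\mathbb{Z}^D$ with the metric $\mathrm{dist}$ induced by the Euclidean metric; $\mathbb{T}^D\times[0,1]$ carries the usual product metric. Class $\mathcal{T}$: maps $T(\theta,x)=(\omega(\theta),T_\theta(x))$ on $\mathbb{T}^D\times[0,1]$, where $\omega(\theta)=\theta+\rho\bmod 1$ is an irrational rotation ($\rho\in\mathbb{R}^D\setminus\mathbb{Q}^D$) and the fibre maps $T_\theta:[0,1]\to[0,1]$ satisfy: (1) each $T_\theta$ is monotonically increasing (in the weak sense, i.e. non-decreasing); (2) each $T_\theta$ is differentiable and $(\theta,x)\mapsto T_\theta'(x)$ is continuous; (3) $T$ is pinched: there is $\theta_*\in\mathbb{T}^D$ such that $T_{\theta_*}([0,1])$ is a single point; (4) $T_\theta(0)=0$ for all $\theta$. Class $\mathcal{T}^*$: with $\tau_n=\omega^n(\theta_* )$, those $T\in\mathcal{T}$ for which there exist constants $\alpha>2$, $\gamma>0$, $L_0\in(0,1)$, $\beta>0$, $c>0$, $d>1$, $m\in\mathbb{N}$, $a>1$,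 $0<b<1$ such that (i) $|T_\theta(x)-T_\theta(y)|\leq\alpha|x-y|$ for all $\theta$ and $x,y\in[0,1]$; (ii) $|T_\theta(x)-T_\theta(y)|\leq\alpha^{-\gamma}|x-y|$ for all $\theta$ and $x,y\in[L_0,1]$; (iii) $|T_\theta(x)-T_{\theta'}(x)|\leq\beta\,\mathrm{dist}(\theta,\theta')$ for all $\theta,\theta'$ and $x\in[0,1]$; (iv) $\mathrm{dist}(\tau_n,\theta_* )\geq c\,n^{-d}$ for all $n\in\mathbb{N}$; (v) $m>22(1+1/\gamma)$, $a\geq(m+1)^d$, $b\leq c$, and $\mathrm{dist}(\tau_n,\theta_* )>b$ for all $n\in\{1,\dots,m-1\}$; (vi) $T_\theta(x)\geq\min\{L_0,ax\}\cdot\min\{1,\tfrac{2}{b}\mathrm{dist}(\theta,\theta_* )\}$ for all $(\theta,x)\in\mathbb{T}^D\times[0,1]$. Upper bounding graph: $\varphi^+(\theta)=\sup\{x\in[0,1]\mid(\theta,x)\in\mathcal{A}\}$ with $\mathcal{A}=\bigcap_{n\in\mathbb{N}}T^n(\mathbb{T}^D\times[0,1])$; $\Phi^+=\{(\theta,\varphi^+(\theta))\mid\theta\in\mathbb{T}^D\}$. The associated measure is $\mu_{\varphi^+}(A)=\mathrm{Leb}_{\mathbb{T}^D}(\pi_1(A\cap\Phi^+))$ for Borel $A\subseteq\mathbb{T}^D\times[0,1]$, with $\pi_1$ the projection to $\mathbb{T}^D$. Rectifiability: in a separable metric space $X$, a Borel set $A$ is countably $D$-rectifiable if there are Lipschitz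 maps $g_i:A_i\subseteq\mathbb{R}^D\to X$, $i\in\mathbb{N}$, with $\mathcal{H}^D(A\setminus\bigcup_i g_i(A_i))=0$, where $\mathcal{H}^D$ is the $D$-dimensional Hausdorff measure normalised as $\mathcal{H}^D(A)=\lim_{\varepsilon\to0}\inf\{\sum_i(\mathrm{diam}A_i)^D\}$ over finite or countable covers by sets of diameter $\leq\varepsilon$. A finite Borel measure $\mu$ is $D$-rectifiable if $\mu=\Theta\,\mathcal{H}^D|_A$ for some countably $D$-rectifiable $A$ and some Borel measurable $\Theta:A\to[0,\infty)$. Dimensions of $\mu$: the pointwise dimension at $x$ is $\lim_{\varepsilon\to0}\log\mu(B_\varepsilon(x))/\log\varepsilon$ if it exists ($B_\varepsilon(x)$ the open ball); $\mu$ is exact dimensional if this exists and is constant $\mu$-a.e., the constant being denoted $d_\mu$. The information dimension is $D_1(\mu)=\lim_{\varepsilon\to0}\int\log\mu(B_\varepsilon(x))\,d\mu(x)/\log\varepsilon$ if it exists. *)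

(* Defs.v *)
From HB Require Import structures.
From mathcomp Require Import all_boot all_order all_algebra generic_quotient.
From mathcomp Require Import ring_quotient ring.
From mathcomp Require Import all_classical all_reals all_analysis.

Set Implicit Arguments.
Unset Strict Implicit.
Unset Printing Implicit Defensive.

Import Order.TTheory GRing.Theory Num.Theory.
Import numFieldTopology.Exports numFieldNormedType.Exports.
Import Quotient.

Local Open Scope classical_set_scope.
Local Open Scope ring_scope.
Local Open Scope quotient_scope.

#[short(type="pmetricType")]
HB.structure Definition PMetric (K : numDomainType) :=
  {M of Metric K M & Pointed M}.

(* The canonical norm on 'rV[R]_D is the sup norm; this is the Euclidean one. *)
Definition enorm (R : realType) (D : nat) (v : 'rV[R]_D) : R :=
  Num.sqrt (\sum_(i < D) v 0 i ^+ 2).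

Section enorm_theory.
Variables (R : realType) (D : nat).
Implicit Types u v : 'rV[R]_D.

Let sumsq_ge0 v : 0 <= \sum_(i < D) v 0 i ^+ 2.
Proof. by apply: sumr_ge0 => i _; exact: sqr_ge0. Qed.

Lemma enorm_ge0 v : 0 <= enorm v.
Proof. exact: sqrtr_ge0. Qed.

Lemma enorm_sqr v : enorm v ^+ 2 = \sum_(i < D) v 0 i ^+ 2.
Proof. by rewrite sqr_sqrtr. Qed.

Lemma enorm0 : enorm (0 : 'rV[R]_D) = 0.
Proof.
by rewrite /enorm big1 ?sqrtr0// => i _; rewrite mxE expr0n.
Qed.

Lemma enormN v : enorm (- v) = enorm v.
Proof. by congr Num.sqrt; apply: eq_bigr => i _; rewrite mxE sqrrN. Qed.

Lemma ler_coord_enorm v i : `|v 0 i| <= enorm v.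
Proof.
rewrite -(@ler_pXn2r _ 2) ?nnegrE ?enorm_ge0// enorm_sqr real_normK ?num_real//.
by rewrite (bigD1 i)//= lerDl sumr_ge0// => j _; exact: sqr_ge0.
Qed.

Lemma enorm0_eq0 v : enorm v = 0 -> v = 0.
Proof.
move=> v0; apply/rowP => i; rewrite mxE; apply/eqP; rewrite -normr_eq0.
by rewrite eq_le normr_ge0 andbT -v0 ler_coord_enorm.
Qed.

Lemma enorm_triangle u v : enorm (u + v) <= enorm u + enorm v.
Proof.
set a := enorm u; set b := enorm v.
have [/eqP a0|a0] := boolP (a == 0).
  by rewrite (enorm0_eq0 a0) add0r lerDr enorm_ge0.
have [/eqP b0|b0] := boolP (b == 0).
  by rewrite (enorm0_eq0 b0) addr0 lerDl enorm_ge0.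
have ap : 0 < a by rewrite lt_neqAle eq_sym a0 enorm_ge0.
have bp : 0 < b by rewrite lt_neqAle eq_sym b0 enorm_ge0.
rewrite -(@ler_pXn2r _ 2) ?nnegrE ?addr_ge0 ?enorm_ge0// enorm_sqr.
apply: (@le_trans _ _ (\sum_(i < D)
    ((1 + b / a) * u 0 i ^+ 2 + (1 + a / b) * v 0 i ^+ 2))).
  apply: ler_sum => i _; rewrite mxE -subr_ge0.
  have -> : (1 + b / a) * u 0 i ^+ 2 + (1 + a / b) * v 0 i ^+ 2 -
      (u 0 i + v 0 i) ^+ 2 = (b * u 0 i - a * v 0 i) ^+ 2 / (a * b).
    by rewrite !expr2; field; rewrite a0 b0.
  by rewrite divr_ge0 ?sqr_ge0// mulr_ge0// ltW.
rewrite big_split/= -!mulr_sumr -!enorm_sqr -/a -/b.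
rewrite le_eqVlt; apply/orP; left; apply/eqP.
by rewrite !expr2; field; rewrite a0 b0.
Qed.

End enorm_theory.

Section torus.
Variables (R : realType) (D : nat).

Definition int_lattice : {pred 'rV[R]_D} :=
  [pred v : 'rV[R]_D | [forall i, v 0 i \is a Num.int]].

Let int_lattice_closed : zmod_closed int_lattice.
Proof.
split=> [|u v]; first by apply/forallP => i; rewrite mxE.
by move=> /forallP uZ /forallP vZ; apply/forallP => i; rewrite !mxE rpredB.
Qed.

HB.instance Definition _ :=
  GRing.isZmodClosed.Build 'rV[R]_D int_lattice int_lattice_closed.

Definition torus : Type := {quot int_lattice}.

HB.instance Definition _ := GRing.Zmodule.on torus.

Definition proj_torus (v : 'rV[R]_D) : torus := \pi_{quot int_lattice} v.

Definition torus_dist (p q : torus) : R :=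
  inf [set enorm (x - y) | x in [set x | proj_torus x = p] &
                           y in [set y | proj_torus y = q]].

Let projP u v : proj_torus u = proj_torus v <-> (u - v) \in int_lattice.
Proof. by rewrite idealrBE; split=> [/eqP|/eqP]. Qed.

Let proj_repr (p : torus) : proj_torus (repr p) = p.
Proof. exact: reprK. Qed.

Let D_set (p q : torus) : set R :=
  [set enorm (x - y) | x in [set x | proj_torus x = p] &
                       y in [set y | proj_torus y = q]].

Let D_set_has_inf p q : has_inf (D_set p q).
Proof.
split.
  exists (enorm (repr p - repr q)); exists (repr p); first exact: proj_repr.
  by exists (repr q) => //; exact: proj_repr.
by exists 0 => _ [x _ [y _ <-]]; exact: enorm_ge0.
Qed.

Let dist_le x y : torus_dist (proj_torus x) (proj_torus y) <= enorm (x - y).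
Proof.
apply: inf_lbound; first exact: (D_set_has_inf _ _).2.
by exists x => //; exists y.
Qed.

Let dist_ge0 p q : 0 <= torus_dist p q.
Proof.
apply: lb_le_inf; first exact: (D_set_has_inf p q).1.
by move=> _ [x _ [y _ <-]]; exact: enorm_ge0.
Qed.

Let dist_adh p q (e : R) : 0 < e -> exists x y,
  [/\ proj_torus x = p, proj_torus y = q & enorm (x - y) < torus_dist p q + e].
Proof.
move=> e0; have [_ [x xp [y yq <-]] xye] := inf_adherent e0 (D_set_has_inf p q).
by exists x, y.
Qed.

Let torus_distxx p : torus_dist p p = 0.
Proof.
apply/eqP; rewrite eq_le dist_ge0 andbT -(proj_repr p).
by rewrite (le_trans (dist_le _ _))// subrr enorm0.
Qed.

Let torus_dist_sym p q : torus_dist p q = torus_dist q p.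
Proof.
congr inf; apply/seteqP; split=> _ [x xp [y yq <-]];
  by exists y => //; exists x => //; rewrite -enormN opprB.
Qed.

Let torus_dist_triangle q p r :
  torus_dist p r <= torus_dist p q + torus_dist q r.
Proof.
apply/ler_addgt0Pl => e e0; have e20 : 0 < e / 2 by rewrite divr_gt0.
have [x [y [xp yq xy]]] := dist_adh p q e20.
have [y' [z [y'q zr yz]]] := dist_adh q r e20.
have zr' : proj_torus (z + (y - y')) = r.
  rewrite -zr; apply/projP; rewrite addrAC subrr add0r; apply/projP.
  by rewrite yq y'q.
rewrite -xp -zr' (le_trans (dist_le _ _))//.
have -> : x - (z + (y - y')) = (x - y) + (y' - z).
  by rewrite !opprD opprK; apply/rowP => i; rewrite !mxE; ring.
rewrite (le_trans (enorm_triangle _ _))// ltW//.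
by rewrite xp zr' (lt_le_trans (ltrD xy yz))// addrACA -splitr addrC.
Qed.

Let torus_dist_positivity p q : torus_dist p q = 0 -> p = q.
Proof.
move=> pq0; have h0 : 0 < 2^-1 / 2 :> R by rewrite divr_gt0 ?invr_gt0.
have [x [y [xp yq]]] := dist_adh p q h0; rewrite pq0 add0r => xyh.
suff xy0 : x - y = 0 by rewrite -xp -yq; congr proj_torus; apply/subr0_eq.
apply: enorm0_eq0; apply/eqP; rewrite eq_le enorm_ge0 andbT.
apply/ler_addgt0Pl => e e0.
have e'0 : 0 < Num.min e (2^-1 / 2) by rewrite lt_min e0 h0.
have [x' [y' [x'p y'q]]] := dist_adh p q e'0.
rewrite pq0 add0r lt_min addr0 => /andP[xye xyh'].
rewrite (_ : x - y = x' - y') ?ltW//.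
have : (x - x') - (y - y') \in int_lattice.
  by rewrite rpredB//; apply/projP; rewrite ?xp ?yq.
move=> /forallP xyZ; apply/rowP => i; apply/eqP; rewrite -subr_eq0.
have := xyZ i; have -> : ((x - x') - (y - y')) 0 i =
    (x - y) 0 i - (x' - y') 0 i by rewrite !mxE; ring.
set t := (X in X \is a Num.int) => tZ.
have t1 : `|t| < 2^-1 / 2 + 2^-1 / 2.
  apply: le_lt_trans (ler_normB _ _) _; apply: ltrD.
    exact: le_lt_trans (ler_coord_enorm _ _) xyh.
  exact: le_lt_trans (ler_coord_enorm _ _) xyh'.
apply: contraTT t1 => t0; rewrite -splitr -leNgt.
by apply: le_trans (norm_intr_ge1 tZ t0); rewrite invf_le1// ler1n.
Qed.

HB.instance Definition _ := isMetric.Build R torus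
  torus_distxx torus_dist_positivity torus_dist_sym torus_dist_triangle.

HB.instance Definition _ := isPointed.Build torus 0.

End torus.

Section lebesgue.
Variable R : realType.

(* n-dimensional Lebesgue measure as an iterated integral, in the same way as
   [(m1 \x m2) A = \int[m1]_x m2 (xsection A x)]. *)
Fixpoint lebesgue_rV (n : nat) : set 'rV[R]_n -> \bar R :=
  match n return set 'rV[R]_n -> \bar R with
  | 0 => fun A => (\1_A (0 : 'rV[R]_0))%:E
  | n'.+1 => fun A => (\int[lebesgue_measure]_x
      lebesgue_rV [set v : 'rV[R]_n' |
                   A (row_mx (const_mx x : 'rV[R]_1) v : 'rV[R]_(1 + n'))])%E
  end.

Definition lebesgue_torus (D : nat) (A : set (torus R D)) : \bar R :=
  lebesgue_rV [set v : 'rV[R]_D |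
    (forall i, 0 <= v 0 i < 1) /\ A (proj_torus v)].

End lebesgue.

Definition unit_interval (R : realType) : Type := set_type (`[0, 1]%classic : set R).

Section unit_interval_metric.
Variable R : realType.

HB.instance Definition _ :=
  PseudoMetric.copy (unit_interval R) (set_type (`[0, 1]%classic : set R)).

Definition uval (x : unit_interval R) : R := \val x.

Lemma uval_itv (x : unit_interval R) : 0 <= uval x <= 1.
Proof. by have := set_valP x; rewrite /= in_itv. Qed.

Let zero_itv : (0 : R) \in (`[0, 1]%classic : set R).
Proof. by rewrite inE /= in_itv/= lexx ler01. Qed.

HB.instance Definition _ :=
  isPointed.Build (unit_interval R) (exist _ 0 zero_itv).

Definition unit_interval_dist (x y : unit_interval R) : R := `|uval x - uval y|.

Let dist_ge0 x y : 0 <= unit_interval_dist x y.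
Proof. exact: normr_ge0. Qed.

Let dist_positivity x y : unit_interval_dist x y = 0 -> x = y.
Proof. by move/normr0_eq0/eqP; rewrite subr_eq0 => /eqP/val_inj. Qed.

Let ballE (x : unit_interval R) e :
  ball x e = [set y | unit_interval_dist x y < e].
Proof. by []. Qed.

HB.instance Definition _ := PseudoMetric_isMetric.Build R (unit_interval R)
  dist_ge0 dist_positivity ballE.

End unit_interval_metric.

Section prod_metric.
Variables (R : realType) (X Y : metricType R).

(* The maximum distance, which induces the balls of the canonical product
   pseudometric structure. *)
Definition prod_dist (p q : X * Y) : R :=
  Num.max (mdist p.1 q.1) (mdist p.2 q.2).

Let dist_ge0 p q : 0 <= prod_dist p q.
Proof. by rewrite le_max mdist_ge0. Qed.

Let dist_positivity p q : prod_dist p q = 0 -> p = q.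
Proof.
case: p q => [x y] [x' y'] /eqP; rewrite eq_le dist_ge0 andbT ge_max/=.
move=> /andP[xx' yy']; congr pair; apply: mdist_positivity; apply/eqP;
  by rewrite eq_le mdist_ge0 andbT.
Qed.

Let ballE (p : X * Y) e : ball p e = [set q | prod_dist p q < e].
Proof.
apply/seteqP; split=> q; rewrite /ball/= /prod_ball/= !ballEmdist/= gt_max.
  by move=> [-> ->].
by move=> /andP[].
Qed.

HB.instance Definition _ := PseudoMetric_isMetric.Build R (X * Y)%type
  dist_ge0 dist_positivity ballE.

End prod_metric.

HB.instance Definition _ (R : realType) (X Y : pmetricType R) :=
  Metric.on (X * Y)%type.

Notation borel X := (g_sigma_algebraType (@open X)).

Section geometric_measure_theory.
Variables (R : realType) (X : pmetricType R).
Local Open Scope ereal_scope.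

(* The diameter of the empty set is 0, so that finite covers are countable ones
   padded with empty sets (in positive dimension). *)
Definition diam (A : set X) : \bar R :=
  maxe 0 (ereal_sup [set (mdist x y)%:E | x in A & y in A]).

Definition hausdorff_content (s : nat) (e : R) (A : set X) : \bar R :=
  ereal_inf [set \sum_(i <oo) diam (F i) ^+ s |
             F in [set F : nat -> set X |
                   A `<=` \bigcup_i F i /\ forall i, diam (F i) <= e%:E]].

Definition hausdorff (s : nat) (A : set X) : \bar R :=
  lim (hausdorff_content s e A @[e --> (0%R : R)^'+]).

Definition lipschitz_from (s : nat) (E : set 'rV[R]_s) (g : 'rV[R]_s -> X) :=
  exists L : R, forall u v, E u -> E v ->
    (mdist (g u) (g v) <= L * enorm (u - v))%R.

Definition countably_rectifiable (s : nat) (A : set X) :=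
  measurable (A : set (borel X)) /\
  exists (E : nat -> set 'rV[R]_s) (g : nat -> 'rV[R]_s -> X),
    (forall i, lipschitz_from (E i) (g i)) /\
    hausdorff s (A `\` \bigcup_i (g i @` E i)) = 0.

Definition finite_borel_measure (mu : set X -> \bar R) :=
  exists m : {finite_measure set (borel X) -> \bar R},
    forall B : set (borel X), measurable B -> mu B = m B.

Definition rectifiable_measure (s : nat) (mu : set X -> \bar R) :=
  finite_borel_measure mu /\
  exists (A : set X) (Theta : borel X -> R),
    [/\ countably_rectifiable s A,
        measurable_fun (A : set (borel X)) Theta,
        (forall x, A x -> (0 <= Theta x)%R) &
        forall B : set (borel X), measurable B ->
          mu B = \int[(hausdorff s : set (borel X) -> \bar R)]_(x in A `&` B)
                   (Theta x)%:E].

(* [lne 0 = -oo], so that points outside the support of mu have infinite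
   pointwise dimension. *)
Definition is_pointwise_dim (mu : set X -> \bar R) (x : X) (d : \bar R) :=
  lne (mu (ball x e)) * (ln e)^-1%:E @[e --> (0%R : R)^'+] --> d.

Definition is_exact_dim (mu : set X -> \bar R) (d : \bar R) :=
  {ae (mu : set (borel X) -> \bar R), forall x : borel X, is_pointwise_dim mu x d}.

Definition is_information_dim (mu : set X -> \bar R) (d : \bar R) :=
  (\int[(mu : set (borel X) -> \bar R)]_x lne (mu (ball (x : X) e)))
    * (ln e)^-1%:E @[e --> (0%R : R)^'+] --> d.

End geometric_measure_theory.

Definition phase (R : realType) (D : nat) : Type :=
  (torus R D * unit_interval R)%type.
HB.instance Definition _ (R : realType) (D : nat) :=
  PMetric.copy (phase R D) (torus R D * unit_interval R)%type.

Section pinched_skew_product.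
Variables (R : realType) (D : nat).
Implicit Types (T : phase R D -> phase R D) (rho : 'rV[R]_D).
Implicit Types (thetas : torus R D).

Definition rotation rho (theta : torus R D) : torus R D :=
  theta + proj_torus rho.

Definition fibre_map T (theta : torus R D) (x : unit_interval R) :
  unit_interval R := (T (theta, x)).2.

(* The difference quotients are taken inside [0, 1]: one-sided at 0 and 1. *)
Definition has_fibre_derivative T (dT : phase R D -> R) :=
  forall theta (x : unit_interval R),
    (uval (fibre_map T theta y) - uval (fibre_map T theta x)) / (uval y - uval x)
      @[y --> x^'] --> dT (theta, x).

(* Membership in the class T, with the rotation vector and the pinching point
   exhibited. *)
Record pinched_skew_product T rho thetas : Prop := PinchedSkewProduct {
  psp_base : forall p, (T p).1 = rotation rho p.1 ;
  psp_irrational : ~ (forall i, exists q : rat, rho 0 i = ratr q) ;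
  psp_monotone : forall theta x y, uval x <= uval y ->
    uval (fibre_map T theta x) <= uval (fibre_map T theta y) ;
  psp_C1 : exists2 dT : phase R D -> R,
    has_fibre_derivative T dT & continuous dT ;
  psp_pinched : exists x0, range (fibre_map T thetas) = [set x0] ;
  psp_zero : forall theta x, uval x = 0 -> uval (fibre_map T theta x) = 0
}.

Record star_conditions T rho thetas (alpha gamma L0 beta c d : R) (m : nat)
    (a b : R) : Prop := StarConditions {
  star_alpha : 2 < alpha ;
  star_gamma : 0 < gamma ;
  star_L0 : 0 < L0 < 1 ;
  star_beta : 0 < beta ;
  star_c : 0 < c ;
  star_d : 1 < d ;
  star_m : (0 < m)%N ;
  star_a : 1 < a ;
  star_b : 0 < b < 1 ;
  star_lipschitz : forall theta x y,
    `|uval (fibre_map T theta x) - uval (fibre_map T theta y)|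
      <= alpha * `|uval x - uval y| ;
  star_contracting : forall theta x y, L0 <= uval x -> L0 <= uval y ->
    `|uval (fibre_map T theta x) - uval (fibre_map T theta y)|
      <= alpha `^ (- gamma) * `|uval x - uval y| ;
  star_base_lipschitz : forall theta theta' x,
    `|uval (fibre_map T theta x) - uval (fibre_map T theta' x)|
      <= beta * mdist theta theta' ;
  star_diophantine : forall n, (0 < n)%N ->
    c * n%:R `^ (- d) <= mdist (iter n (rotation rho) thetas) thetas ;
  star_m_large : 22 * (1 + gamma^-1) < m%:R ;
  star_a_large : m.+1%:R `^ d <= a ;
  star_b_small : b <= c ;
  star_no_early_return : forall n, (0 < n < m)%N ->
    b < mdist (iter n (rotation rho) thetas) thetas ;
  star_lower_bound : forall theta x,
    Num.min L0 (a * uval x) * Num.min 1 (2 / b * mdist theta thetas)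
      <= uval (fibre_map T theta x)
}.

Definition class_T_star T := exists rho thetas,
  pinched_skew_product T rho thetas /\
  exists (alpha gamma L0 beta c d : R) (m : nat) (a b : R),
    star_conditions T rho thetas alpha gamma L0 beta c d m a b.

Definition global_attractor T : set (phase R D) :=
  \bigcap_(n in [set n | (0 < n)%N]) (iter n T @` setT).

Definition upper_bounding_graph T (theta : torus R D) : R :=
  sup [set uval x | x in [set x | global_attractor T (theta, x)]].

Definition graph_set (phi : torus R D -> R) : set (phase R D) :=
  [set p | uval p.2 = phi p.1].

(* No measurability of phi is built in: that this is a finite Borel measure is
   part of [rectifiable_measure]. *)
Definition graph_measure (phi : torus R D -> R) (A : set (phase R D)) : \bar R :=
  lebesgue_torus (fst @` (A `&` graph_set phi)).

End pinched_skew_product.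

(* Main.v *)
(* The images of the top curve under the iterates of T decrease to the upper
   bounding graph.  Fix j and keep only the points theta that lie, for every
   i >= j, outside a ball of exponentially small radius around the i-th iterate of
   theta_*.  Along the orbit ending over theta each passage near the pinched fibre
   then costs a recovery time controlled by its depth, and the Diophantine
   condition makes deep passages so rare that contraction wins over expansion: on
   this set the image curves are Lipschitz with a constant independent of the
   iterate, hence so is the upper bounding graph.  By Borel-Cantelli these sets
   exhaust the torus up to a null set, so the measure lives on countably many
   Lipschitz graphs.  The projection to the torus is 1-Lipschitz, so sets that are
   null for the Hausdorff measure are null for mu, and Radon-Nikodym gives the
   density.

   For the dimensions, projecting a ball gives mu(B_e(x)) <= (6 e)^D.  Conversely,
   if S is covered by n sets of diameter less than e / 2, then
   mu {x in S | mu(B_e(x)) <= t} <= n t, and the integral over S of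
   - ln mu(B_e(x)) is at most 1 + mu(S) ln n.  On a Lipschitz piece n = O(e^-D),
   so Borel-Cantelli along e = exp(-k) gives the pointwise dimension.  For the
   information dimension the rest of the space, covered by O(e^-(D+1)) sets,
   contributes only in proportion to its small measure. *)
Require Import Defs.
From HB Require Import structures.
From mathcomp Require Import all_boot all_order all_algebra generic_quotient.
From mathcomp Require Import ring_quotient ring lra zify.
From mathcomp Require Import all_classical all_reals all_analysis.
From mathcomp Require Import measurable_realfun.

Set Implicit Arguments.
Unset Strict Implicit.
Unset Printing Implicit Defensive.

Import Order.TTheory GRing.Theory Num.Theory.
Import numFieldTopology.Exports numFieldNormedType.Exports.
Import Quotient.

Local Open Scope classical_set_scope.
Local Open Scope ring_scope.

(** * Lebesgue measure on the torus *)

(** All measures in the statement are bare set functions, so each is first matched with a genuine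
    measure: the iterated integral by induction on the dimension, [hausdorff] by Caratheodory's
    criterion, the graph measure as the push-forward of Lebesgue measure under the map from theta to
    its point on the graph. The Lipschitz bound is a race between two rates. A step contracts by
    [alpha] to the power [- gamma] only if both compared orbits lie above [L0]; any other step may
    expand by [alpha]. The loss of height at a passage is counted in powers of [a], and each power
    is regained in one step, so the lower bound for the height evolves like a queue. Passages of
    depth p are at least of order m 2^p steps apart. Summed over p, this leaves one orbit below [L0]
    for at most about 6/m of the time: 4/m from the geometric series, 2/m from the greatest depth
    allowed. Two orbits give 12/m, and the lower bound on [m] makes the balance negative. On the
    whole phase space the D-dimensional Hausdorff measure is not sigma-finite, which is why
    Radon-Nikodym is applied to its restriction to the union of the Lipschitz pieces. *)

Definition cylinders (R : realType) n : set (set 'rV[R]_n) :=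
  [set A | exists i (B : set R), measurable B /\ A = [set v : 'rV[R]_n | B (v 0 i)]].

Notation rVc R n := (g_sigma_algebraType (@cylinders R n)).

Section coordinate_sigma_algebra.
Variable R : realType.

Lemma measurable_coord n (i : 'I_n) :
  measurable_fun [set: rVc R n] (fun v : rVc R n => (v : 'rV[R]_n) 0 i).
Proof.
move=> _ B mB; rewrite setTI; apply: sub_sigma_algebra.
by exists i, B.
Qed.

Lemma measurable_coords d (T : measurableType d) n (f : T -> rVc R n) :
  (forall i, measurable_fun setT (fun t => (f t : 'rV[R]_n) 0 i)) ->
  measurable_fun setT f.
Proof.
move=> mf; apply: (@measurability _ _ _ _ setT f (@cylinders R n)) => //.
move=> _ [_ [i [B [mB ->]]] <-].
exact: mf.
Qed.

Definition unit_cube n : set 'rV[R]_n := [set v | forall i, 0 <= v 0 i < 1].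

Definition row_cons n (x : R) (v : 'rV[R]_n) : 'rV[R]_n.+1 :=
  row_mx (const_mx x : 'rV[R]_1) v : 'rV[R]_(1 + n).

Lemma row_cons0 n x (v : 'rV[R]_n) : row_cons x v 0 ord0 = x.
Proof.
rewrite /row_cons; have -> : (ord0 : 'I_n.+1) = lshift n (ord0 : 'I_1).
  exact/val_inj.
exact: etrans (row_mxEl _ _ _ _) (mxE _ _ _ _).
Qed.

Lemma row_consS n x (v : 'rV[R]_n) i : row_cons x v 0 (lift ord0 i) = v 0 i.
Proof.
rewrite /row_cons; have -> : lift ord0 i = rshift 1 i by exact/val_inj.
exact: row_mxEr.
Qed.

Lemma lebesgue_rVS n (A : set 'rV[R]_n.+1) : lebesgue_rV A =
  (\int[lebesgue_measure]_x lebesgue_rV [set v | A (row_cons x v)])%E.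
Proof. by []. Qed.

Lemma lebesgue_rV0 n : lebesgue_rV (set0 : set 'rV[R]_n) = 0%E.
Proof.
elim: n => [|n IH]; first by rewrite /= indic0.
rewrite lebesgue_rVS; under eq_integral do rewrite (_ : [set _ | _] = set0)// IH.
by rewrite integral0.
Qed.

Lemma forall_row_cons n (E : 'I_n.+1 -> set R) x (v : 'rV[R]_n) :
  (forall i, E i (row_cons x v 0 i)) <->
  E ord0 x /\ forall i, E (lift ord0 i) (v 0 i).
Proof.
split=> [Ev|[E0 ES] i].
  split; first by have := Ev ord0; rewrite row_cons0.
  by move=> i; have := Ev (lift ord0 i); rewrite row_consS.
case: (unliftP ord0 i) => [j ->|->]; first by rewrite row_consS.
by rewrite row_cons0.
Qed.

(** The outer integrand is a constant times the indicator of [E ord0], so the product formula needs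
    no measure structure on [lebesgue_rV]. *)
Lemma lebesgue_rV_box n (E : 'I_n -> set R) :
  (forall i, measurable (E i)) -> (forall i, lebesgue_measure (E i) < +oo)%E ->
  lebesgue_rV [set v : 'rV[R]_n | forall i, E i (v 0 i)] =
  (\prod_(i < n) fine (lebesgue_measure (E i)))%:E.
Proof.
elim: n E => [|n IH] E mE Efin.
  rewrite big_ord0 /= indicE mem_set//= => -[]//.
rewrite lebesgue_rVS big_ord_recl EFinM fineK; last first.
  by rewrite ge0_fin_numE ?measure_ge0.
rewrite -IH// -(setIT (E ord0)) -integral_indic//.
rewrite muleC -ge0_integralZl//=.
- apply: eq_integral => x _ /=; rewrite indicE.
  have [/set_mem E0|/negP E0] := boolP (x \in E ord0).
    rewrite mule1; congr lebesgue_rV; apply/seteqP; split=> v /=.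
      by move=> /forall_row_cons[].
    by move=> Ev; apply/forall_row_cons.
  rewrite mule0 [X in lebesgue_rV X](_ : _ = set0) ?lebesgue_rV0//.
  apply/seteqP; split=> v //= /forall_row_cons[E0' _]; apply: E0.
  by rewrite inE.
- by apply/measurable_EFinP; apply: measurable_indic; exact: mE.
- rewrite (IH (fun i => E (lift ord0 i)))// lee_fin.
  by rewrite prodr_ge0// => i _; exact/fine_ge0.
- exact: mE.
Qed.

Section cube_step.
Variables (n : nat) (P : probability (rVc R n) R).
Hypothesis PE : forall A : set (rVc R n), measurable A ->
  P A = lebesgue_rV [set v | unit_cube v /\ A v].

Let f (p : measurableTypeR R * rVc R n) : rVc R n.+1 := row_cons p.1 p.2.

Let mf : measurable_fun setT f.
Proof.
apply: measurable_coords => i; case: (unliftP ord0 i) => [j ->|->].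
  under eq_fun do rewrite /f row_consS.
  by apply: measurableT_comp (measurable_coord j) _; exact: measurable_snd.
under eq_fun do rewrite /f row_cons0.
exact: measurable_fst.
Qed.

#[local] HB.instance Definition _ := isMeasurableFun.Build _ _ _ _ f mf.

Let D : set (measurableTypeR R * rVc R n) := `[0%R, 1%R[%classic `*` setT.

Let mD : measurable D. Proof. exact: measurableX. Qed.

(** Only the first factor is cut down to [[0, 1[]: by [PE] the measure [P] is already carried by the
    unit cube. *)
Let M : set (measurableTypeR R * rVc R n) -> \bar R :=
  mrestr (lebesgue_measure \x P)%E mD.

#[local] HB.instance Definition _ := Measure.on M.

Let MT : M setT = 1%E.
Proof.
rewrite /M/= /mrestr setTI product_measure1E//.
rewrite [X in (_ * X)%E]probability_setT mule1.
transitivity (lebesgue_measure (`[0%R, 1%R[%classic : set R)) => //.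
by rewrite lebesgue_measure_itv/= lte01 sube0.
Qed.

#[local] HB.instance Definition _ := Measure_isProbability.Build _ _ _ M MT.

Let ME A : measurable A ->
  distribution M f A = lebesgue_rV [set v | unit_cube v /\ A v].
Proof.
move=> mA; rewrite lebesgue_rVS /distribution /pushforward /M /mrestr.
rewrite /product_measure1; apply: eq_integral => x _ /=; rewrite PE; last first.
  apply: measurable_xsection; rewrite -[X in measurable X]setTI.
  rewrite setTI; apply: measurableI => //.
  by rewrite -[X in measurable X]setTI; apply: mf.
congr lebesgue_rV; apply/seteqP; split => v /=.
  rewrite /xsection/= inE /f/= /D/= in_itv/= => -[cv [Av [x01 _]]]; split => //.
  by apply/(@forall_row_cons n (fun=> [set y | 0 <= y < 1])).
move=> [/(@forall_row_cons n (fun=> [set y | 0 <= y < 1]))[/= x01 cv] Av].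
by split => //; rewrite /xsection/= inE /f/= /D/= in_itv.
Qed.

Lemma cube_step : exists P' : probability (rVc R n.+1) R,
  forall A : set (rVc R n.+1), measurable A ->
  P' A = lebesgue_rV [set v | unit_cube v /\ A v].
Proof. by exists (distribution M f) => A /ME. Qed.

End cube_step.

(** The coordinate sigma-algebra makes every section of a measurable set measurable, which lets the
    iterated integral be recognised one coordinate at a time as a product measure pushed forward by
    [row_cons]. *)
Lemma cube_probability n : exists P : probability (rVc R n) R,
  forall A : set (rVc R n), measurable A ->
  P A = lebesgue_rV [set v | unit_cube v /\ A v].
Proof.
elim: n => [|n [P PE]]; last exact: (cube_step PE).
exists \d_(0 : rVc R 0) => A mA; rewrite /dirac/= !indicE.
congr (_ %:R%:E); congr nat_of_bool; apply/idP/idP; rewrite !inE.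
  by move=> A0; split => // -[].
by case.
Qed.

End coordinate_sigma_algebra.

Local Open Scope quotient_scope.

(** * The Euclidean metric of the torus and its grids *)

Section torus_metric.
Variables (R : realType) (D : nat).
Implicit Types (u v x y : 'rV[R]_D) (p q s : torus R D).

Lemma proj_torusP u v :
  proj_torus u = proj_torus v <-> forall i, (u - v) 0 i \is a Num.int.
Proof.
have -> : (proj_torus u = proj_torus v) <-> ((u - v) \in @int_lattice R D).
  by rewrite idealrBE; split=> /eqP.
by split=> /forallP.
Qed.

Lemma proj_torusD u v : proj_torus (u + v) = proj_torus u + proj_torus v.
Proof. exact: (raddfD (\pi_{quot (@int_lattice R D)})). Qed.

Lemma proj_torus_repr p : proj_torus (repr p) = p.
Proof. exact: reprK. Qed.

Lemma torus_lift p : exists v, unit_cube v /\ proj_torus v = p.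
Proof.
exists (\row_i (repr p 0 i - (Num.floor (repr p 0 i))%:~R)); split.
  move=> i; rewrite mxE subr_ge0 floor_le ltrBlDr addrC.
  by have := floorD1_gt (repr p 0 i); rewrite intrD.
rewrite -[RHS]proj_torus_repr; apply/proj_torusP => i.
by rewrite !mxE addrAC subrr add0r rpredN intr_int.
Qed.

Let dist_set p q : set R := [set enorm (x - y) |
  x in [set x | proj_torus x = p] & y in [set y | proj_torus y = q]].

Let dist_set_has_inf p q : has_inf (dist_set p q).
Proof.
split.
  exists (enorm (repr p - repr q)); exists (repr p); first exact: proj_torus_repr.
  by exists (repr q) => //; exact: proj_torus_repr.
by exists 0 => _ [x _ [y _ <-]]; exact: enorm_ge0.
Qed.

Lemma mdist_proj_le x y : mdist (proj_torus x) (proj_torus y) <= enorm (x - y).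
Proof.
apply: inf_lbound; first exact: (dist_set_has_inf _ _).2.
by exists x => //; exists y.
Qed.

(** The infimum runs over lifts of both points; translating an almost optimal pair by a lattice
    vector fixes the first lift at [x]. *)
Lemma mdist_lift x q (r : R) : mdist (proj_torus x) q < r ->
  exists2 y, proj_torus y = q & enorm (x - y) < r.
Proof.
move=> xqr; have e0 : 0 < r - mdist (proj_torus x) q by rewrite subr_gt0.
have [_ [x' x'x [y' y'q <-]]] :=
  inf_adherent e0 (dist_set_has_inf (proj_torus x) q).
rewrite -[inf _]/(mdist (proj_torus x) q) [X in _ < X]addrC subrK => x'y'.
exists (y' + (x - x')).
  rewrite -y'q; apply/proj_torusP => i; rewrite addrAC subrr add0r.
  by move: i; apply/proj_torusP; rewrite x'x.
rewrite (_ : x - _ = x' - y')//.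
by apply/rowP => i; rewrite !mxE; ring.
Qed.

Lemma mdist_torusDr p q s : mdist (p + s) (q + s) = mdist p q.
Proof.
suff H p' q' s' : mdist (p' + s') (q' + s') <= mdist p' q'.
  by apply/eqP; rewrite eq_le H -{1}(addrK s p) -{1}(addrK s q) H.
apply/ler_addgt0Pl => e e0; rewrite -(proj_torus_repr p') -(proj_torus_repr s').
have : mdist (proj_torus (repr p')) q' < e + mdist (proj_torus (repr p')) q'.
  by rewrite ltrDr.
move=> /mdist_lift[y <- xy]; rewrite -!proj_torusD.
rewrite (le_trans (mdist_proj_le _ _))// opprD addrACA subrr addr0.
by rewrite ltW.
Qed.

Lemma ler_enorm_sum v : enorm v <= \sum_(i < D) `|v 0 i|.
Proof.
rewrite -(@ler_pXn2r _ 2) ?nnegrE ?enorm_ge0 ?sumr_ge0// enorm_sqr.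
apply: (@le_trans _ _ (\sum_(i < D) `|v 0 i| * \sum_(j < D) `|v 0 j|)).
  apply: ler_sum => i _; rewrite -real_normK ?num_real// expr2 ler_wpM2l//.
  by rewrite (bigD1 i)//= lerDl sumr_ge0.
by rewrite -mulr_suml expr2.
Qed.

Lemma ler_enorm v (r : R) : (forall i, `|v 0 i| <= r) -> enorm v <= D%:R * r.
Proof.
move=> vr; rewrite (le_trans (ler_enorm_sum v))//.
rewrite (le_trans (ler_sum _ (fun i _ => vr i)))// sumr_const card_ord.
by rewrite mulr_natl.
Qed.

(** Half-open cubes of side [1 / N.+1]. Over all [N] and [z] they are countably many, which serves
    measurability; over the unit cube finitely many, which serves covering numbers. *)
Definition grid_cell (N : nat) (z : {ffun 'I_D -> int}) : set 'rV[R]_D :=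
  [set v | forall i, Num.floor (v 0 i * N.+1%:R) = z i].

Lemma grid_cell_enorm N z u v : grid_cell N z u -> grid_cell N z v ->
  enorm (u - v) <= D%:R / N.+1%:R.
Proof.
move=> uz vz; apply: ler_enorm => i; rewrite !mxE.
have fv := vz i; have fu := uz i; have N0 : 0 < N.+1%:R :> R by [].
rewrite -(ler_pM2r N0) mulVf ?gt_eqF//.
have -> (t : R) : `|t| * N.+1%:R = `|t * N.+1%:R| by rewrite normrM (gtr0_norm N0).
rewrite mulrBl; move: fu fv.
set a := _ * _; set b := _ * _ => fa fb.
have := floorD1_gt a; have := floorD1_gt b; rewrite fa fb intrD.
have := floor_le a; have := floor_le b; rewrite fa fb.
by move: ((z i)%:~R : R) => c *; rewrite ler_norml; lra.
Qed.

Lemma grid_cell_measurable N z : measurable (grid_cell N z : set (rVc R D)).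
Proof.
rewrite (_ : grid_cell N z = \bigcap_(i : 'I_D)
  [set v : 'rV[R]_D | Num.floor (v 0 i * N.+1%:R) = z i]).
  apply: fin_bigcap_measurable; first exact: finite_finset.
  move=> i _; apply: sub_sigma_algebra; exists i.
  exists (`[(z i)%:~R / N.+1%:R, (z i + 1)%:~R / N.+1%:R[%classic); split => //.
  apply/seteqP; split => v /=; rewrite in_itv/= ler_pdivrMr// ltr_pdivlMr//.
    by move=> <-; rewrite floor_le floorD1_gt.
  by move=> ?; apply: floor_def.
by apply/seteqP; split => v /= vz i; [move=> _|]; exact: vz.
Qed.

End torus_metric.

Local Close Scope quotient_scope.

Lemma mdist_open (R : realType) (X : metricType R) (x : X) (r : R) :
  open [set y | mdist x y < r].
Proof.
rewrite openE => y /= xyr; apply/nbhs_ballP; exists (r - mdist x y) => /=.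
  by rewrite subr_gt0.
move=> z; rewrite ballEmdist/= ltrBrDl; apply: le_lt_trans.
exact: metric_triangle.
Qed.

Lemma open_borel (X : ptopologicalType) (U : set X) :
  open U -> measurable (U : set (borel X)).
Proof. exact: sub_sigma_algebra. Qed.

Lemma mdist_ball_borel (R : realType) (X : pmetricType R) (x : X) (r : R) :
  measurable ([set y | mdist x y < r] : set (borel X)).
Proof. by apply: open_borel; exact: mdist_open. Qed.

Lemma set1_borel (R : realType) (X : pmetricType R) (p : X) :
  measurable ([set p] : set (borel X)).
Proof.
rewrite (_ : [set p] = \bigcap_n [set q | mdist p q < n.+1%:R^-1]).
  by apply: bigcapT_measurable => n; exact: mdist_ball_borel.
apply/seteqP; split => [_ -> n _ /=|q pq]; first by rewrite mdistxx invr_gt0.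
apply/esym/mdist_positivity/eqP; rewrite eq_le mdist_ge0 andbT.
rewrite leNgt; apply/negP => q0.
have := pq (Num.truncn (mdist p q)^-1) I; rewrite /= ltNge => /negP; apply.
by rewrite invf_ple ?posrE// ltW// truncnS_gt.
Qed.

(** * Lebesgue measure of balls in the torus *)

Section torus_lebesgue.
Variables (R : realType) (D : nat).
Implicit Types (u v x y : 'rV[R]_D) (p q s : torus R D).

(** The preimage of an open set is the union of the countably many grid cells contained in it. *)
Lemma measurable_proj_torus :
  measurable_fun setT (@proj_torus R D : rVc R D -> borel (torus R D)).
Proof.
apply: (@measurability _ _ (rVc R D) (borel (torus R D)) setT
  (@proj_torus R D) (@open (torus R D))) => //.
move=> _ [U oU <-]; rewrite setTI.
pose I := (nat * {ffun 'I_D -> int})%type.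
pose C (k : I) := if pselect (grid_cell k.1 k.2 `<=` (@proj_torus R D) @^-1` U)
  then (grid_cell k.1 k.2 : set (rVc R D)) else set0.
rewrite (_ : _ @^-1` U = \bigcup_k C k); last first.
  apply/seteqP; split=> [v Uv|v [[N z] _]]; last first.
    by rewrite /C/=; case: pselect => // h /h.
  have [e /= e0 eU] : nbhs_ball (proj_torus v) U.
    by rewrite nbhs_ballE; exact: open_nbhs_nbhs.
  pose N := Num.truncn (D%:R / e).
  pose z := [ffun i => Num.floor (v 0 i * N.+1%:R)] : {ffun 'I_D -> int}.
  have vz : grid_cell N z v by move=> i; rewrite ffunE.
  exists (N, z) => //; rewrite /C/=; case: pselect => // nU.
  exfalso; apply: nU => w wz /=.
  apply: eU; rewrite ballEmdist/=.
  rewrite (le_lt_trans (mdist_proj_le _ _))//.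
  rewrite (le_lt_trans (grid_cell_enorm vz wz))//.
  rewrite ltr_pdivrMr// mulrC -ltr_pdivrMr//.
  by rewrite truncnS_gt.
apply: countable_bigcupT_measurable => [|k]; first exact: countableP.
by rewrite /C; case: pselect => h /=; [exact: grid_cell_measurable|exact: measurable0].
Qed.

#[local] HB.instance Definition _ := isMeasurableFun.Build _ _ _ _
  (@proj_torus R D : rVc R D -> borel (torus R D)) measurable_proj_torus.

Lemma torus_probability : exists P : probability (borel (torus R D)) R,
  forall B : set (borel (torus R D)), measurable B -> P B = lebesgue_torus B.
Proof.
have [P PE] := cube_probability R D.
exists (distribution P (@proj_torus R D : rVc R D -> borel (torus R D))) => B mB.
rewrite /distribution /pushforward [LHS]PE//.
by rewrite -[X in measurable X]setTI; apply: measurable_proj_torus.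
Qed.

(** The trace on the unit interval of a coordinate interval of the torus: the ball may wrap around,
    so three unit translates of an interval of length 2r occur. Their total length is the origin of
    the factor 6. *)
Let window (c r : R) : set R := `[0%R, 1%R[%classic `&`
  (`]c - 1 - r, c - 1 + r[%classic `|` `]c - r, c + r[%classic
   `|` `]c + 1 - r, c + 1 + r[%classic).

Let window_measurable c r : measurable (window c r).
Proof. by apply: measurableI => //; do 2 apply: measurableU => //. Qed.

Let window_lebesgue c r : 0 < r ->
  (lebesgue_measure (window c r) <= (6 * r)%:E)%E.
Proof.
move=> r0; have itvE a : lebesgue_measure (`]a - r, a + r[%classic : set R) = (2 * r)%:E.
  rewrite lebesgue_measure_itv/= lte_fin ifT; last by lra.
  by rewrite -EFinB; congr EFin; lra.
apply: (@le_trans _ _ ((2 * r)%:E + (2 * r)%:E + (2 * r)%:E)%E); last first.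
  by rewrite -!EFinD lee_fin; lra.
rewrite -{1}(itvE (c - 1)) -{1}(itvE c) -(itvE (c + 1)).
apply: (le_trans (measureIr _ _ _)) => //; first by do 2 apply: measurableU => //.
apply: (le_trans (measureU2 _ _ _)) => //; first by apply: measurableU => //.
by rewrite leeD2r// measureU2.
Qed.

Lemma torus_ball_box p (r : R) : 0 < r <= 1 -> exists y : 'rV[R]_D,
  forall v, unit_cube v -> mdist p (proj_torus v) < r ->
  forall i, window (y 0 i) r (v 0 i).
Proof.
move=> /andP[r0 r1]; have [y [y01 <-]] := torus_lift p.
exists y => v v01 /mdist_lift[w wv yw] i.
have {}yw : `|y 0 i - w 0 i| < r.
  by apply: le_lt_trans yw; have := ler_coord_enorm (y - w) i; rewrite !mxE.
have /proj_torusP/(_ i) := wv; rewrite !mxE => /intrP[k wk].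
have := v01 i; have := y01 i; move: yw; rewrite ltr_norml.
have -> : w 0 i = v 0 i + k%:~R by rewrite -wk; ring.
move=> /andP[a1 a2] /andP[b1 b2] /andP[c1 c2].
rewrite /window; split; first by rewrite /= in_itv/= c1 c2.
(* Both coordinates lie in [0, 1) and the lifts differ by less than [r <= 1], so the integer shift
   [k] has modulus below 2. *)
have k2 : k < 2 by rewrite -(ltr_int R) -[2%:~R]/(2 : R); lra.
have k2' : - 2%:Z < k by rewrite -(ltr_int R) mulrNz -[2%:~R]/(2 : R); lra.
have [k1|[k1|k1]] : k = 1 \/ k = 0 \/ k = -1 by lia.
- left; left; rewrite /= in_itv/=; move: a1 a2; rewrite k1 -[1%:~R]/(1 : R).
  by move=> ? ?; apply/andP; split; lra.
- left; right; rewrite /= in_itv/=; move: a1 a2; rewrite k1 -[0%:~R]/(0 : R).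
  by move=> ? ?; apply/andP; split; lra.
- right; rewrite /= in_itv/=; move: a1 a2; rewrite k1 mulrNz -[1%:~R]/(1 : R).
  by move=> ? ?; apply/andP; split; lra.
Qed.

Variable P : probability (borel (torus R D)) R.
Hypothesis PE :
  forall B : set (borel (torus R D)), measurable B -> P B = lebesgue_torus B.

(** For [r > 1] the right-hand side is at least 1; otherwise the lifted ball lies in a product of
    windows, each of length at most 6r. *)
Lemma torus_ball_le p (r : R) : 0 <= r ->
  (P [set q | (mdist p q < r)%R] <= ((6 * r) ^+ D)%:E)%E.
Proof.
rewrite le_eqVlt => /predU1P[<-|r0].
  rewrite (_ : [set _ | _] = set0) ?measure0 ?lee_fin ?mulr0 ?exprn_ge0//.
  by apply/seteqP; split => // q /=; rewrite ltNge mdist_ge0.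
have [r1|r1] := lerP r 1; last first.
  rewrite (le_trans (probability_le1 P _))//; first exact: mdist_ball_borel.
  by rewrite lee_fin exprn_ege1//; lra.
have [y yE] := torus_ball_box p (introT andP (conj r0 r1)).
have mball := mdist_ball_borel p r.
rewrite PE// /lebesgue_torus; have [Q QE] := cube_probability R D.
pose W := [set v : 'rV[R]_D | forall i, window (y 0 i) r (v 0 i)].
have mW : measurable (W : set (rVc R D)).
  rewrite (_ : W = \bigcap_(i : 'I_D) [set v | window (y 0 i) r (v 0 i)]).
    apply: fin_bigcap_measurable; first exact: finite_finset.
    by move=> i _; apply: sub_sigma_algebra; exists i, (window (y 0 i) r).
  by apply/seteqP; split => v /= vz i; [move=> _|]; exact: vz.
apply: (@le_trans _ _ (lebesgue_rV [set v : 'rV[R]_D | unit_cube v /\ W v])).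
  set B := (X in lebesgue_rV X).
  have mB : measurable (@proj_torus R D @^-1` [set q | mdist p q < r] : set (rVc R D)).
    by rewrite -[X in measurable X]setTI; apply: measurable_proj_torus.
  rewrite (_ : B = [set v | unit_cube v /\ ([set v | unit_cube v] `&`
      @proj_torus R D @^-1` [set q | mdist p q < r]) v]); last first.
    by apply/seteqP; split => v /= [vc]; [move=> vr; split|case].
  have mC : measurable (@unit_cube R D : set (rVc R D)).
    rewrite (_ : @unit_cube R D = \bigcap_(i : 'I_D)
        [set v | `[0%R, 1%R[%classic (v 0 i)]).
      apply: fin_bigcap_measurable; first exact: finite_finset.
      by move=> i _; apply: sub_sigma_algebra; exists i, (`[0%R, 1%R[%classic).
    apply/seteqP; split => v /= vz i.
      by move=> _; rewrite /= in_itv/=; exact: vz.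
    by have := vz i I; rewrite /= in_itv.
  have mCB := measurableI _ _ mC mB.
  rewrite -(QE _ mCB) -(QE _ mW); apply: le_measure; rewrite ?inE//.
  by move=> v [v01 vr]; exact: (yE v v01 vr).
rewrite (_ : [set v | _] = W); last first.
  apply/seteqP; split => v /=; first by case.
  by move=> vw; split => // i; have [] := vw i; rewrite /= in_itv.
rewrite (lebesgue_rV_box (fun i => window_measurable (y 0 i) r)); last first.
  by move=> i; rewrite (le_lt_trans (window_lebesgue _ r0))// ltry.
rewrite lee_fin -[X in _ ^+ X]card_ord -prodr_const; apply: ler_prod => i _.
rewrite fine_ge0//= -lee_fin fineK ?window_lebesgue//.
by rewrite ge0_fin_numE// (le_lt_trans (window_lebesgue _ r0))// ltry.
Qed.

End torus_lebesgue.

(** * Hausdorff measure *)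

Section metric_outer_measure.
Variables (R : realType) (X : pmetricType R).
Local Open Scope ereal_scope.

Definition far_apart (A B : set X) :=
  exists2 r : R, (0 < r)%R & forall x y, A x -> B y -> (r <= mdist x y)%R.

Definition inner_part (U : set X) (n : nat) : set X :=
  [set x | forall y, ~ U y -> (n.+1%:R^-1 <= mdist x y)%R].

Lemma inner_part_nd U : nondecreasing_seq (inner_part U).
Proof.
move=> m n mn; apply/subsetPset => x Ux y /Ux; apply: le_trans.
by rewrite lef_pV2 ?posrE// ler_nat.
Qed.

Lemma inner_part_sub U n : inner_part U n `<=` U.
Proof.
move=> x Ux; apply: contrapT => /Ux; rewrite mdistxx leNgt.
by rewrite invr_gt0 ltr0Sn.
Qed.

Lemma bigcup_inner_part U : open U -> \bigcup_n inner_part U n = U.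
Proof.
move=> oU; apply/seteqP; split=> [x [n _]|x Ux]; first exact: inner_part_sub.
have /nbhs_ballP[e /= e0 eU] : nbhs x U by exact: open_nbhs_nbhs.
exists (Num.truncn e^-1) => // y Uy; rewrite leNgt; apply/negP => xy.
apply/Uy/eU; rewrite ballEmdist/=; apply: (lt_trans xy).
by rewrite invf_plt ?posrE// truncnS_gt.
Qed.

Lemma inner_part_far_apart U n :
  far_apart (inner_part U n) (~` inner_part U n.+1).
Proof.
exists (n.+1%:R^-1 - n.+2%:R^-1)%R.
  by rewrite subr_gt0 ltf_pV2 ?posrE// ltr_nat.
move=> x y Ux /existsNP[z /not_implyP[Uz /negP]]; rewrite -ltNge => yz.
rewrite lerBlDr; apply: (le_trans (Ux _ Uz)).
by apply: (le_trans (metric_triangle _ y _)); rewrite lerD2l ltW.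
Qed.

Lemma far_apartS A A' B B' : A `<=` A' -> B `<=` B' ->
  far_apart A' B' -> far_apart A B.
Proof.
by move=> AA' BB' [r r0 rE]; exists r => // x y /AA' ? /BB' ?; exact: rE.
Qed.

Variable nu : {outer_measure set X -> \bar R}.
Hypothesis nu_far_apart : forall A B, far_apart A B ->
  nu A + nu B <= nu (A `|` B).

(** Caratheodory's criterion for metric outer measures. The inner parts of [U] are far apart from
    its complement, and what they miss is the tail of a convergent series of shells. *)
Lemma far_apart_open_caratheodory U : open U -> nu.-caratheodory U.
Proof.
move=> oU; apply: le_caratheodory_measurable => Z.
have [->|Zoo] := eqVneq (nu Z) +oo; first exact: leey.
(* Every other shell [W k.+2 `\` W k.+1] is far apart from the previous ones,
   so the shells of either parity have total measure at most [nu Z]. *)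
pose W := inner_part U; pose r k := nu (Z `&` (W k.+2 `\` W k.+1)).
have r0 k : 0 <= r k by exact: outer_measure_ge0.
have WS m n : (m <= n)%N -> W m `<=` W n.
  by move=> mn; apply/subsetPset; exact: inner_part_nd.
have sum_b b n : \sum_(i < n) r (i.*2 + b)%N <= nu (Z `&` W (n.*2 + b)%N).
  elim: n => [|n IHn]; first by rewrite big_ord0.
  rewrite big_ord_recr/=; apply: (le_trans (leeD2r _ IHn)).
  apply: (@le_trans _ _ (nu ((Z `&` W (n.*2 + b)%N) `|`
      (Z `&` (W (n.*2 + b).+2 `\` W (n.*2 + b).+1))))).
    apply: nu_far_apart; apply: far_apartS (@inner_part_far_apart U (n.*2 + b)).
      by move=> ? [].
    by move=> ? [_ []].
  apply: le_outer_measure => x [[Zx Wx]|[Zx [Wx _]]]; split => //.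
  by apply: WS Wx; rewrite doubleS !addSn; exact: leqW.
have sum2 n : \sum_(i < n.*2) r i <= nu Z + nu Z.
  apply: (@le_trans _ _ (\sum_(i < n) r (i.*2 + 0)%N + \sum_(i < n) r (i.*2 + 1)%N)).
    rewrite -big_split/=; elim: n => [|n IHn]; first by rewrite !big_ord0.
    rewrite doubleS !big_ord_recr/= addn0 addn1 -addeA.
    by apply: leeD.
  apply: leeD; apply: (le_trans (sum_b _ _)); apply: le_outer_measure;
    exact: subIsetl.
have Zfin : nu Z \is a fin_num by rewrite ge0_fin_numE ?outer_measure_ge0// ltey.
have rfin : \sum_(k <oo) r k < +oo.
  apply: (@le_lt_trans _ _ (nu Z + nu Z)); last by rewrite lte_add_pinfty// ltey.
  apply: lime_le; first exact: is_cvg_nneseries.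
  near=> n; apply: (le_trans _ (sum2 n)); rewrite big_mkord.
  rewrite -!(big_mkord xpredT r); apply: (@lee_sum_nneg_natr _ _ xpredT) => //.
  by rewrite -addnn leq_addr.
have tail n : nu (Z `&` U) + nu (Z `&` ~` U) <= nu Z + \sum_(n <= k <oo) r k.
  apply: (@le_trans _ _ (nu (Z `&` W n.+1) + \sum_(n <= k <oo) r k +
      nu (Z `&` ~` U))).
    apply: leeD2r.
    apply: (@le_trans _ _ (nu ((Z `&` W n.+1) `|`
        \bigcup_(k in ~` `I_n) (Z `&` (W k.+2 `\` W k.+1))))).
      apply: le_outer_measure => x [Zx]; rewrite -{1}(bigcup_inner_part oU).
      move=> [m _ Wm]; have [mn|nm] := leqP m n.+1.
        by left; split => //; apply: WS Wm.
      have [Wx|nWx] := pselect (W n.+1 x); first by left.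
      (* The least [j] with [x] in [W j] exceeds [n.+1], so [x] lies in the shell of index [j - 2],
         which is at least [n]. *)
      right; pose P j := `[< W j x >].
      have exP : exists j, P j by exists m; apply/asboolP.
      case: (ex_minnP exP) => j /asboolP Wj jmin.
      have nj : (n.+1 < j)%N.
        by rewrite ltnNge; apply/negP => jn; apply: nWx; apply: WS Wj.
      exists j.-2 => /=; first by apply/negP; rewrite -leqNgt; lia.
      have jE : j = j.-2.+2 by lia.
      split => //; split; first by rewrite -jE.
      by move=> /asboolP /jmin; rewrite {1}jE ltnn.
    apply: (le_trans (outer_measureU2 _ _ _)); apply: leeD2l.
    exact: outer_measure_sigma_subadditive_tail.
  rewrite addeAC leeD2r//; apply: le_trans (nu_far_apart _) _.
    exists (n.+2%:R^-1)%R => [|x y [_ Wx] [_ Uy]]; first by rewrite invr_gt0.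
    exact: Wx.
  by apply: le_outer_measure => x [[]|[]].
have cvgZ : nu Z + \sum_(n <= k <oo) r k @[n --> \oo] --> nu Z + 0.
  apply: cvgeD; [by rewrite fin_num_adde_defr|exact: cvg_cst|].
  exact: nneseries_tail_cvg.
rewrite -[leRHS]adde0 -(cvg_lim _ cvgZ)//; apply: lime_ge.
  by apply/cvg_ex; exists (nu Z + 0).
by near=> n; exact: tail.
Unshelve. all: by end_near. Qed.

End metric_outer_measure.

Section hausdorff_measure.
Variables (R : realType) (X : pmetricType R) (s : nat).
Hypothesis s_gt0 : (0 < s)%N.
Local Open Scope ereal_scope.
Implicit Types (A B : set X) (e : R).

Lemma diam_ge0 A : 0 <= diam A. Proof. by rewrite /diam le_max lexx. Qed.

Lemma diam0 : diam (set0 : set X) = 0.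
Proof.
rewrite /diam (_ : [set _ | _ in _ & _ in _] = set0).
  by rewrite ereal_sup0 maxEge leNye.
by apply/seteqP; split => // _ [x []].
Qed.

Lemma diam_le A e : (0 <= e)%R ->
  (forall x y, A x -> A y -> (mdist x y <= e)%R) -> diam A <= e%:E.
Proof.
move=> e0 Ae; rewrite /diam ge_max lee_fin e0/=; apply: ge_ereal_sup.
by move=> _ [x Ax [y Ay <-]]; rewrite lee_fin Ae.
Qed.

Lemma mdist_le_diam A x y : A x -> A y -> (mdist x y)%:E <= diam A.
Proof.
move=> Ax Ay; rewrite /diam le_max; apply/orP; right.
by apply: ereal_sup_ubound; exists x => //; exists y.
Qed.

(* With all sets measurable, a cover by sets of diameter at most [e] is a cover
   by measurable sets on which [gauge e] is finite. *)
Let dX := g_sigma_algebraType [set: set X].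

Let gauge e : set dX -> \bar R :=
  fun A => if diam A <= e%:E then diam A ^+ s else +oo.

Let gauge_ge0 e A : 0 <= gauge e A.
Proof. by rewrite /gauge; case: ifPn => // _; rewrite expe_ge0 ?diam_ge0. Qed.

Let gauge0 e : (0 < e)%R -> gauge e set0 = 0.
Proof.
move=> e0; rewrite /gauge diam0 lee_fin ltW//.
by case: (s) s_gt0 => // n _; rewrite expeS mul0e.
Qed.

(** A cover containing a set of diameter above [e] has infinite [gauge] sum, so the diameter
    constraint may be dropped and the general theory of outer measures applies. *)
Let content_mu_ext e A : hausdorff_content s e A = mu_ext (gauge e) A.
Proof.
apply/eqP; rewrite eq_le; apply/andP; split.
  apply: le_ereal_inf_tmp => _ [F [mF AF] <-].
  have [Fe|/existsNP[i /negP Fi]] := pselect (forall i, diam (F i) <= e%:E).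
    apply: ereal_inf_lbound; exists F => //.
    by apply: eq_eseriesr => i _; rewrite /gauge Fe.
  rewrite (@eseries_pinfty _ _ _ i) ?leey//.
    by move=> n _; rewrite -ltNye (lt_le_trans _ (gauge_ge0 e _)).
  by rewrite /gauge (negbTE Fi).
apply: le_ereal_inf_tmp => _ [F [AF Fe] <-].
apply: ereal_inf_lbound; exists F.
  by split => // i; exact: sub_sigma_algebra.
by apply: eq_eseriesr => i _; rewrite /gauge Fe.
Qed.

Lemma hausdorff_content_le e e' A : (e <= e')%R ->
  hausdorff_content s e' A <= hausdorff_content s e A.
Proof.
move=> ee'; apply: ereal_inf_le_tmp => _ [F [AF Fe] <-]; exists F => //.
by split => // i; rewrite (le_trans (Fe i))// lee_fin.
Qed.

Lemma hausdorff_content_cvg A : hausdorff_content s e A @[e --> (0%R : R)^'+] -->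
  ereal_sup [set hausdorff_content s e A | e in `]0%R, +oo[%classic].
Proof.
apply: (nonincreasing_at_right_cvge (BInfty _ false)) => // e e' _ _ ee'.
exact: hausdorff_content_le.
Qed.

Lemma hausdorffE A : hausdorff s A =
  ereal_sup [set hausdorff_content s e A | e in `]0%R, +oo[%classic].
Proof. by apply/cvg_lim => //; exact: hausdorff_content_cvg. Qed.

Lemma hausdorff_content_le_hausdorff e A : (0 < e)%R ->
  hausdorff_content s e A <= hausdorff s A.
Proof.
move=> e0; rewrite hausdorffE; apply: ereal_sup_ubound; exists e => //=.
by rewrite in_itv/= e0.
Qed.

Lemma hausdorff_content_ge0 e A : 0 <= hausdorff_content s e A.
Proof. by rewrite content_mu_ext; apply: mu_ext_ge0; exact: gauge_ge0. Qed.

Lemma hausdorff_ge0 A : 0 <= hausdorff s A.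
Proof.
apply: le_trans (hausdorff_content_le_hausdorff A ltr01).
exact: hausdorff_content_ge0.
Qed.

Lemma le_hausdorff_content e A B : A `<=` B ->
  hausdorff_content s e A <= hausdorff_content s e B.
Proof. by rewrite !content_mu_ext => AB; exact: le_mu_ext. Qed.

Lemma le_hausdorff A B : A `<=` B -> hausdorff s A <= hausdorff s B.
Proof.
move=> AB; rewrite [leLHS]hausdorffE; apply: ge_ereal_sup => _ [e + <-].
rewrite /= in_itv/= andbT => e0; apply: (le_trans (le_hausdorff_content e AB)).
exact: hausdorff_content_le_hausdorff.
Qed.

Lemma hausdorff0 : hausdorff s (set0 : set X) = 0.
Proof.
rewrite hausdorffE; apply/eqP; rewrite eq_le; apply/andP; split; last first.
  by rewrite -hausdorffE hausdorff_ge0.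
apply: ge_ereal_sup => _ [e + <-]; rewrite /= in_itv/= andbT => e0.
by rewrite content_mu_ext (mu_ext0 (gauge0 e0) (gauge_ge0 e)).
Qed.

Lemma hausdorff_sigma_subadditive : sigma_subadditive (@hausdorff R X s).
Proof.
move=> F; rewrite [leLHS]hausdorffE; apply: ge_ereal_sup => _ [e + <-].
rewrite /= in_itv/= andbT => e0.
apply: (@le_trans _ _ (\sum_(i <oo) hausdorff_content s e (F i))).
  under eq_eseriesr do rewrite content_mu_ext; rewrite content_mu_ext.
  by apply: mu_ext_sigma_subadditive; exact: gauge_ge0.
apply: lee_nneseries => [i _ _|i _]; first exact: hausdorff_content_ge0.
by rewrite hausdorff_content_le_hausdorff.
Qed.

HB.instance Definition _ := isOuterMeasure.Build R X (@hausdorff R X s)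
  hausdorff0 hausdorff_ge0 le_hausdorff hausdorff_sigma_subadditive.

(** A set of diameter below the gap cannot meet both [A] and [B], so every fine cover of the union
    splits into disjoint subfamilies covering the two. *)
Lemma hausdorff_far_apart A B : far_apart A B ->
  hausdorff s A + hausdorff s B <= hausdorff s (A `|` B).
Proof.
move=> [r r0 ABr].
have contentU e : (0 < e < r)%R ->
    hausdorff_content s e A + hausdorff_content s e B <= hausdorff s (A `|` B).
  move=> /andP[e0 er].
  apply: le_trans (hausdorff_content_le_hausdorff _ e0).
  apply: le_ereal_inf_tmp => _ [F [ABF Fe] <-].
  pose part C i := if `[< F i `&` C !=set0 >] then F i else set0.
  have part_diam C i : diam (part C i) <= e%:E.
    by rewrite /part; case: asboolP => // _; rewrite diam0 lee_fin ltW.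
  have part_cover C : C `<=` A `|` B -> C `<=` \bigcup_i part C i.
    move=> CAB x Cx; have [i _ Fix] := ABF _ (CAB _ Cx).
    by exists i => //; rewrite /part asboolT//; exists x.
  have expr_ge0 (C : set X) : 0 <= diam C ^+ s by rewrite expe_ge0 ?diam_ge0.
  apply: (@le_trans _ _
      (\sum_(i <oo) (diam (part A i) ^+ s + diam (part B i) ^+ s))).
    rewrite nneseriesD//; apply: leeD; apply: ereal_inf_lbound.
      by exists (part A) => //; split => //; apply: part_cover => ?; left.
    by exists (part B) => //; split => //; apply: part_cover => ?; right.
  apply: lee_nneseries => [i _ _|i _]; first by rewrite adde_ge0.
  have diam0s : diam (set0 : set X) ^+ s = 0.
    by rewrite diam0; case: (s) s_gt0 => // n _; rewrite expeS mul0e.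
  rewrite /part; case: asboolP => [[x [Fx Ax]]|_]; last first.
    by rewrite diam0s add0e; case: asboolP => // _; rewrite diam0s.
  case: asboolP => [[y [Fy By]]|_]; last by rewrite diam0s adde0.
  have := ABr _ _ Ax By; rewrite leNgt => /negP[].
  by rewrite -lte_fin (le_lt_trans (mdist_le_diam Fx Fy))// (le_lt_trans (Fe i)).
have cvgD : hausdorff_content s e A + hausdorff_content s e B
    @[e --> (0%R : R)^'+] --> hausdorff s A + hausdorff s B.
  rewrite !hausdorffE; apply: cvgeD; [|exact: hausdorff_content_cvg..].
  by rewrite ge0_adde_def// inE -hausdorffE hausdorff_ge0.
rewrite -(cvg_lim _ cvgD)//; apply: lime_le.
  by apply/cvg_ex; eexists; exact: cvgD.
near=> e; apply: contentU; apply/andP; split; near: e.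
  exact: nbhs_right_gt.
exact: nbhs_right_lt.
Unshelve. all: by end_near. Qed.

Lemma hausdorff_borel : exists H : {measure set (borel X) -> \bar R},
  (H : set (borel X) -> \bar R) = @hausdorff R X s.
Proof.
pose nu := [the {outer_measure set X -> \bar R} of @hausdorff R X s].
have borelC (A : set (borel X)) :
    measurable A -> measurable (A : set (caratheodory_type nu)).
  apply: smallest_sub => [|U oU].
    exact: sigma_algebra_measurable.
  by apply: far_apart_open_caratheodory => //; exact: hausdorff_far_apart.
have sadd : semi_sigma_additive (@hausdorff R X s : set (borel X) -> \bar R).
  move=> F mF tF mUF.
  apply: (@measure_semi_sigma_additive _ (caratheodory_type nu) R nu) => //.
    by move=> i; exact: borelC.
  exact: borelC.
pose H : set (borel X) -> \bar R := @hausdorff R X s.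
by exists (HB.pack_for {measure set (borel X) -> \bar R} H
  (isMeasure.Build _ _ _ H hausdorff0 hausdorff_ge0 sadd)).
Qed.

End hausdorff_measure.

(** * Recovery times of pinched orbits *)

Section workload.
Variables (S : nat -> nat).

(* The backlog of a queue that serves one unit per step and to which step [t]
   adds [S t] units: a passage at distance [a ^- S t] of the pinched fibre costs
   [S t] steps of recovery, during which nothing is known but the expansion. *)
Fixpoint workload (t : nat) : nat :=
  if t is t'.+1 then ((workload t').-1 + S t')%N else 0%N.

(** Conservation law of the queue: a busy step serves exactly one unit, so what remains plus what
    was served equals the initial backlog plus the arrivals. *)
Lemma workload_balance u v : (u <= v)%N ->
  (workload v + \sum_(u <= t < v) (0 < workload t) =
   workload u + \sum_(u <= t < v) S t)%N.
Proof.
move=> /subnKC <-; elim: (v - u)%N => [|k IHk].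
  by rewrite addn0 !big_geq// addn0.
rewrite addnS !big_nat_recr ?leq_addr//= addnA.
have : ((workload (u + k)).-1 + (0 < workload (u + k)) = workload (u + k))%N.
  by case: (workload _) => //= w; rewrite addn1.
lia.
Qed.

(** Backlog inherited at time [k] is handled by going back to the last idle time [u]. All steps from
    [u] to [k] except [u] itself are busy; as [c <= m], discarding them pays for replacing [n - u]
    by [n - k], up to the one extra [m]. *)
Lemma busy_le (c m n t1 C : nat) : (c <= m)%N -> (t1 <= n)%N ->
  (forall u, (u <= t1)%N -> (m * \sum_(u <= t < t1) S t <= c * (n - u) + C)%N) ->
  forall k, (k <= t1)%N ->
  (m * \sum_(k <= t < t1) (0 < workload t) <= c * (n - k) + C + m)%N.
Proof.
move=> cm t1n Sle k kt1.
have [u [uk Yu busy]] : exists u, [/\ (u <= k)%N, workload u = 0%N &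
    (k - u <= \sum_(u <= t < k) (0 < workload t) + 1)%N].
  elim: k {kt1} => [|k [u [uk Yu busy]]]; first by exists 0%N.
  case: (posnP (workload k.+1)) => [Y0|Yk].
    by exists k.+1; rewrite subnn.
  case: (posnP (workload k)) => [Y0|Yk0].
    by exists k; rewrite leqnSn; split => //; rewrite subSnn; lia.
  exists u; split => //; first exact: leqW.
  rewrite big_nat_recr//= Yk0 subSn//; lia.
have := Sle u (leq_trans uk kt1).
have := workload_balance (leq_trans uk kt1); rewrite Yu add0n => bal.
have : (\sum_(u <= t < t1) (0 < workload t) <= \sum_(u <= t < t1) S t)%N.
  by rewrite -bal leq_addl.
rewrite (big_cat_nat _ (n := k))//=.
set B := (\sum_(u <= t < k) _)%N in busy *; set B' := (\sum_(k <= t < t1) _)%N.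
set SS := (\sum_(u <= t < t1) S t)%N => BS mS.
have : (m * (B + B') <= c * (n - u) + C)%N.
  by apply: leq_trans mS; rewrite leq_mul2l BS orbT.
nia.
Qed.

End workload.

Lemma count_gap (P : pred nat) (g c u v : nat) : (0 < c)%N ->
  (forall s t, (u <= s)%N -> (s < t)%N -> (t < v)%N -> P s -> P t ->
    (g <= c * (t - s))%N) ->
  (u <= v)%N ->
  (g * \sum_(u <= t < v) P t <= c * (v - u) + c * g)%N.
Proof.
move=> c0 gap uv.
(* Here [x] plays the next marked time after [w]; a fictitious one at [v + g] closes the last
   gap. *)
have H w x : (u <= w <= v)%N -> (w <= x)%N ->
    (forall s, (u <= s < w)%N -> P s -> (g <= c * (x - s))%N) ->
    (g * \sum_(u <= t < w) P t <= c * (x - u))%N.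
  elim: w x => [|w IHw] x /andP[uw wv] wx xs.
    by move: uw; rewrite leqn0 => /eqP ->; rewrite big_geq ?muln0.
  have [wu|uw'] := ltnP w u; first by rewrite big_geq ?muln0.
  rewrite big_nat_recr//= mulnDr; have [/= Pw|/= Pw] := boolP (P w).
    have := xs w; rewrite uw' ltnSn => /(_ isT Pw).
    have : (g * \sum_(u <= t < w) P t <= c * (w - u))%N.
      apply: IHw => //; first by rewrite uw' ltnW.
      by move=> s /andP[us sw] Ps; exact: gap.
    nia.
  rewrite muln0 addn0; apply: IHw => //; first by rewrite uw' ltnW.
    exact: ltnW.
  by move=> s /andP[us sw]; apply: xs; rewrite us ltnS ltnW.
apply: (@leq_trans (c * (v + g - u))); last by nia.
apply: H; rewrite ?uv ?leqnn ?leq_addr// => s /andP[us sv] _; nia.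
Qed.

Section sum_levels.
Variables (S : nat -> nat) (m u v P : nat).
Hypothesis S_gap : forall p s t, (u <= s)%N -> (s < t)%N -> (t < v)%N ->
  (p < S s)%N -> (p < S t)%N -> (m * 2 ^ p <= 2 * (t - s))%N.
Hypothesis S_le : forall t, (u <= t < v)%N -> (S t <= P)%N.

(** Layer-cake summation: [S t] counts the levels [p < S t]. By [count_gap], level [p] is exceeded
    at most [2 (v - u) / (m 2^p) + 2] times; the geometric series gives the 4, the [P] additive
    terms give [2 m P]. *)
Lemma sum_levels_le : (u <= v)%N ->
  (m * \sum_(u <= t < v) S t <= 4 * (v - u) + 2 * m * P)%N.
Proof.
move=> uv.
have level p : (m * \sum_(u <= t < v) (p < S t))%:R <=
    (2 * (v - u))%:R * 2^-1 ^+ p + (2 * m)%:R :> rat.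
  have := @count_gap (fun t => p < S t)%N _ 2 u v isT (@S_gap p) uv.
  rewrite mulnAC mulnA -(ler_nat rat) natrD [X in X <= _]natrM [X in _ + X]natrM => h.
  have p0 : 0 < (2 ^ p)%:R :> rat by rewrite ltr0n expn_gt0.
  rewrite -(ler_pM2r p0); apply: le_trans h _.
  by rewrite mulrDl exprVn -natrX divfK ?gt_eqF.
have sumE : (\sum_(u <= t < v) S t = \sum_(p < P) \sum_(u <= t < v) (p < S t))%N.
  rewrite exchange_big/=; rewrite big_nat [RHS]big_nat; apply: eq_bigr => t uv'.
  rewrite -[LHS](subnKC (leq0n _)) subn0 add0n -{1}(minn_idPr (S_le uv')).
  elim: (P) => [|k IHk]; first by rewrite big_ord0 min0n.
  by rewrite big_ord_recr/= -IHk; case: (ltnP k (S t)); lia.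
rewrite -(ler_nat rat) sumE big_distrr/= natr_sum.
apply: (@le_trans _ _ (\sum_(p < P) ((2 * (v - u))%:R * 2^-1 ^+ p + (2 * m)%:R))).
  by apply: ler_sum => p _; exact: level.
rewrite big_split/= sumr_const card_ord natrD -[X in _ + X <= _]mulr_natr -natrM lerD2r.
rewrite -mulr_sumr (_ : (4 * (v - u) = 2 * (v - u) * 2)%N); last by lia.
rewrite [X in _ <= X]natrM ler_wpM2l//.
suff -> : \sum_(p < P) 2^-1 ^+ p = 2 - 2 * 2^-1 ^+ P :> rat.
  by rewrite gerBl mulr_ge0// exprn_ge0.
elim: (P) => [|k IHk]; first by rewrite big_ord0; lra.
by rewrite big_ord_recr/= IHk exprS; lra.
Qed.

End sum_levels.

Section contraction_sum.
Variables (R : realType) (delta lambda : nat -> R) (e q K : R) (N : nat).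
Hypothesis e_ge0 : 0 <= e.
Hypothesis q01 : 0 < q < 1.
Hypothesis delta0 : delta 0%N = 0.
Hypothesis lambda_ge0 : forall t, 0 <= lambda t.
Hypothesis deltaS : forall t, delta t.+1 <= lambda t * delta t + e.
Hypothesis prod_le : forall k, (k <= N)%N ->
  \prod_(k <= i < N) lambda i <= K * q ^+ (N - k).

(** A discrete Gronwall bound. Only products ending at the fixed time [N] are assumed small, because
    the count of pinched steps is controlled relative to the end of the orbit, not between arbitrary
    times. *)
Lemma contraction_sum : delta N <= e * K / (1 - q).
Proof.
move: q01 => /andP[q0 q1]; have q1' : 0 < 1 - q by rewrite subr_gt0.
(* The potential is the error at time [t] carried forward to time [N]. *)
suff H t : (t <= N)%N -> \prod_(t <= i < N) lambda i * delta t <=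
    e * K / (1 - q) * q ^+ (N - t).
  by have := H N (leqnn _); rewrite big_geq// subnn expr0 mulr1 mul1r.
elim: t => [|t IHt] tN.
  rewrite delta0 mulr0; apply: mulr_ge0; last by rewrite exprn_ge0// ltW.
  apply: divr_ge0; last exact: ltW.
  apply: mulr_ge0 => //; have := prod_le (leqnn N); rewrite big_geq// subnn expr0 mulr1.
  exact: le_trans ler01.
have P0 : 0 <= \prod_(t.+1 <= i < N) lambda i by exact: prodr_ge0.
have := ler_wpM2l P0 (deltaS t); move/le_trans; apply.
have := IHt (ltnW tN); rewrite big_ltn// => IH1.
have := ler_wpM2l e_ge0 (prod_le tN) => IH2.
rewrite (_ : (N - t = (N - t.+1).+1)%N) ?exprS in IH1; last by lia.
move: IH1 IH2; set p := \prod_(_ <= _ < _) _; set z := q ^+ _ => IH1 IH2.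
have -> : e * K / (1 - q) * z = e * K / (1 - q) * (q * z) + e * (K * z).
  by field; rewrite gt_eqF.
by apply: le_trans (lerD IH1 IH2); rewrite le_eqVlt; apply/orP; left; apply/eqP; ring.
Qed.

End contraction_sum.

(** For the last steps of an orbit, where nothing but the global expansion rate is known. *)
Lemma expansion_tail (R : realType) (delta : nat -> R) (e alpha : R) (N : nat) :
  0 <= e -> 1 <= alpha -> (forall t, delta t.+1 <= alpha * delta t + e) ->
  forall i, delta (N + i)%N <= alpha ^+ i * (delta N + e * i%:R).
Proof.
move=> e0 a1 dS; elim=> [|i IHi]; first by rewrite addn0 expr0 mul1r mulr0 addr0.
rewrite addnS (le_trans (dS _))//.
have a0 : 0 <= alpha by lra.
apply: le_trans (_ : alpha * (alpha ^+ i * (delta N + e * i%:R)) + e <= _).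
  by rewrite lerD2r ler_wpM2l.
have ai : 1 <= alpha ^+ i.+1 by rewrite exprn_ege1.
have -> : alpha ^+ i.+1 * (delta N + e * i.+1%:R) =
    alpha * (alpha ^+ i * (delta N + e * i%:R)) + alpha ^+ i.+1 * e.
  by rewrite -[i.+1%:R]natr1 exprS; ring.
by rewrite lerD2l ler_peMl.
Qed.

Lemma before_tail j n t : (j <= n)%N -> (t < n - j)%N ->
  (t <= n)%N /\ (j <= n - t)%N.
Proof. by lia. Qed.

Lemma tail_split j n k : (j <= n)%N -> (k <= n - j)%N ->
  (n - k = n - j - k + j)%N.
Proof. by lia. Qed.

(** * Lipschitz bounds for the images of the top curve *)

Section pinched_dynamics.
Variables (R : realType) (D : nat) (T : phase R D -> phase R D).
Variables (rho : 'rV[R]_D) (thetas : torus R D).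
Hypothesis psp : pinched_skew_product T rho thetas.
Implicit Types (theta eta : torus R D) (x y : unit_interval R).

Let one_itv : (1 : R) \in (`[0, 1]%classic : set R).
Proof. by rewrite inE /= in_itv/= lexx ler01. Qed.

Definition unit_top : unit_interval R := exist _ 1 one_itv.

Definition orbit_top eta t : unit_interval R := (iter t T (eta, unit_top)).2.

Definition backshift theta n : torus R D := theta - proj_torus rho *+ n.

(** The height over [theta] of the n-th image of the curve x = 1: the orbit has to start [n]
    rotations earlier. *)
Definition upper_iterate n theta : R := uval (orbit_top (backshift theta n) n).

Lemma skewE theta x : T (theta, x) = (theta + proj_torus rho, fibre_map T theta x).
Proof. by rewrite [LHS]surjective_pairing (psp_base psp). Qed.

Lemma iter_base n p : (iter n T p).1 = p.1 + proj_torus rho *+ n.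
Proof.
elim: n => [|n IHn]; first by rewrite addr0.
by rewrite iterS (psp_base psp) /rotation IHn mulrSr addrA.
Qed.

Lemma orbit_topS eta t : orbit_top eta t.+1 =
  fibre_map T (eta + proj_torus rho *+ t) (orbit_top eta t).
Proof.
by rewrite /orbit_top iterS {1}(surjective_pairing (iter t T _)) iter_base.
Qed.

Lemma backshift_add theta n t : (t <= n)%N ->
  backshift theta n + proj_torus rho *+ t = backshift theta (n - t).
Proof.
move=> tn.
by rewrite /backshift -{1}(subnK tn) mulrnDr opprD -!addrA addNr addr0.
Qed.

Lemma iter_rotation n theta :
  iter n (rotation rho) theta = theta + proj_torus rho *+ n.
Proof.
by elim: n => [|n IHn]; rewrite ?addr0// iterS IHn /rotation mulrSr addrA.
Qed.

Lemma mdist_backshift theta n : mdist (backshift theta n) thetas =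
  mdist theta (iter n (rotation rho) thetas).
Proof.
by rewrite -(mdist_torusDr _ _ (proj_torus rho *+ n)) subrK iter_rotation.
Qed.

Variables (alpha gamma L0 beta c d : R) (m : nat) (a b : R).
Hypothesis star : star_conditions T rho thetas alpha gamma L0 beta c d m a b.

Let a1 : 1 < a. Proof. exact: star_a star. Qed.
Let a0 : 0 < a. Proof. exact: lt_trans a1. Qed.
Let b0 : 0 < b. Proof. by have /andP[] := star_b star. Qed.
Let m0 : (0 < m)%N. Proof. exact: star_m star. Qed.
Let alpha0 : 0 < alpha. Proof. have := star_alpha star; lra. Qed.
Let gamma0 : 0 < gamma. Proof. exact: star_gamma star. Qed.
Let L00 : 0 < L0. Proof. by have /andP[] := star_L0 star. Qed.

(** The distance at which the factor [2 / b * dist] of the lower bound on the fibre maps drops to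
    [a ^- p], that is, to a loss made good by [p] steps of growth by [a]. *)
Definition pinch_radius p : R := b / 2 * a ^- p.

(** Induction along the queue: below [L0] a step gains a factor [a], which serves one unit, while
    the passage at step [t] loses at most [a ^- S t]. An empty queue thus certifies height at least
    [L0]. *)
Lemma orbit_top_ge eta (S : nat -> nat) N :
  (forall t, (t < N)%N ->
    pinch_radius (S t) <= mdist (eta + proj_torus rho *+ t) thetas) ->
  forall t, (t <= N)%N -> L0 * a ^- workload S t <= uval (orbit_top eta t).
Proof.
move=> SN; elim=> [_|t IHt tN].
  by rewrite expr0 invr1 mulr1; have /andP[_ /ltW] := star_L0 star.
rewrite orbit_topS /=; apply: le_trans (star_lower_bound star _ _).
rewrite exprD invfM mulrA; apply: ler_pM.
- by rewrite mulr_ge0 ?invr_ge0 ?exprn_ge0 ?ltW.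
- by rewrite invr_ge0 exprn_ge0 ?ltW.
- have {}IHt := IHt (ltnW tN); have ax := ler_wpM2l (ltW a0) IHt.
  rewrite le_min; apply/andP; split.
    rewrite ler_piMr ?(ltW L00)// invf_le1 ?exprn_gt0//.
    by rewrite exprn_ege1// ltW.
  apply: le_trans ax; case: (workload S t) => [|w] /=.
    by rewrite expr0 invr1 mulr1 ler_peMl ?ltW.
  by rewrite exprS invfM mulrCA mulVKf ?gt_eqF.
- rewrite le_min; apply/andP; split.
    rewrite invf_le1 ?exprn_gt0//.
    by rewrite exprn_ege1// ltW.
  have := SN _ tN; rewrite /pinch_radius -(ler_pM2l (_ : 0 < 2 / b)) ?divr_gt0//.
  apply: le_trans; rewrite mulrA (_ : 2 / b * (b / 2) = 1) ?mul1r//.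
  by field; rewrite gt_eqF.
Qed.

(** Two visits make [thetas] return to itself within [b * a ^- p] after [t - s] steps. For [p = 0]
    this contradicts the absence of early returns unless [t - s >= m]. For [p > 0] the Diophantine
    bound with [b <= c] and [a >= (m+1)^d] forces [t - s > (m+1)^p], more than the growth in [2 ^ p]
    that is kept. *)
Lemma close_returns eta p s t : (s < t)%N ->
  mdist (eta + proj_torus rho *+ s) thetas < pinch_radius p ->
  mdist (eta + proj_torus rho *+ t) thetas < pinch_radius p ->
  (m * 2 ^ p <= 2 * (t - s))%N.
Proof.
move=> st hs ht; set g := (t - s)%N.
have g0 : (0 < g)%N by rewrite subn_gt0.
have gp : mdist (iter g (rotation rho) thetas) thetas < b * a ^- p.
  rewrite iter_rotation -(mdist_torusDr _ _ (eta + proj_torus rho *+ s - thetas)).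
  rewrite (_ : thetas + _ + _ = eta + proj_torus rho *+ t); last first.
    have -> : proj_torus rho *+ t = proj_torus rho *+ g + proj_torus rho *+ s.
      by rewrite -mulrnDr subnK// ltnW.
    by rewrite addrC addrA subrK -addrA (addrC (_ *+ s)).
  rewrite [thetas + _]addrC subrK.
  apply: le_lt_trans (metric_triangle _ thetas _) _.
  rewrite (metric_sym thetas); apply: lt_le_trans (ltrD ht hs) _.
  by rewrite /pinch_radius -mulrDl -splitr.
case: p hs ht gp => [|p] _ _ gp.
  have [gm|] := ltnP g m; last by lia.
  have := star_no_early_return star (introT andP (conj g0 gm)).
  by move=> h; have := lt_trans h gp; rewrite expr0 invr1 mulr1 ltxx.
have gmp : (m.+1 ^ p.+1 < g)%N.
  rewrite ltnNge; apply/negP => gle.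
  have := star_diophantine star g0; rewrite leNgt => /negP; apply.
  apply: (lt_le_trans gp); apply: ler_pM => //.
  - exact: ltW.
  - by rewrite invr_ge0 exprn_ge0// ltW.
  - exact: star_b_small star.
  rewrite powRN lef_pV2 ?posrE ?exprn_gt0 ?powR_gt0 ?ltr0n//.
  have d0 : 0 <= d by have := star_d star; lra.
  apply: (@le_trans _ _ ((m.+1 ^ p.+1)%:R `^ d)).
    by rewrite ge0_ler_powR// ?nnegrE// ler_nat.
  rewrite natrX -powR_mulrn// powRAC -(powR_mulrn _ (ltW a0)).
  by rewrite ge0_ler_powR ?nnegrE ?powR_ge0 ?(ltW a0)//; exact: star_a_large star.
apply: (@leq_trans (2 * m.+1 ^ p.+1)); last by rewrite leq_mul2l ltnW ?orbT.
rewrite !expnS mulnCA leq_mul2l/=; apply: leq_mul; first exact: leqnSn.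
by case: (p) => // k; rewrite leq_exp2r.
Qed.

Lemma orbit_dist_step (l : R) eta eta' t :
  `|uval (fibre_map T (eta + proj_torus rho *+ t) (orbit_top eta t)) -
    uval (fibre_map T (eta + proj_torus rho *+ t) (orbit_top eta' t))|
    <= l * `|uval (orbit_top eta t) - uval (orbit_top eta' t)| ->
  `|uval (orbit_top eta t.+1) - uval (orbit_top eta' t.+1)|
    <= l * `|uval (orbit_top eta t) - uval (orbit_top eta' t)| +
       beta * mdist eta eta'.
Proof.
move=> hl; rewrite !orbit_topS.
apply: le_trans (ler_distD (uval (fibre_map T (eta + proj_torus rho *+ t)
  (orbit_top eta' t))) _ _) _.
apply: lerD; first exact: hl.
apply: le_trans (star_base_lipschitz star _ _ _) _.
by rewrite mdist_torusDr.
Qed.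

(** The constant grows with [n], but no base point is excluded: this serves the measurability of the
    limit. *)
Lemma upper_iterate_lipschitz_at n : exists L : R, forall theta theta',
  `|upper_iterate n theta - upper_iterate n theta'| <= L * mdist theta theta'.
Proof.
exists (alpha ^+ n * (beta * n%:R)) => theta theta'.
set e := mdist theta theta'.
pose delta t := `|uval (orbit_top (backshift theta n) t) -
  uval (orbit_top (backshift theta' n) t)|.
have be0 : 0 <= beta * e by rewrite mulr_ge0// ?mdist_ge0// ltW// (star_beta star).
have a1' : 1 <= alpha by have := star_alpha star; lra.
have deltaA t : delta t.+1 <= alpha * delta t + beta * e.
  rewrite /e -(mdist_torusDr theta theta' (- (proj_torus rho *+ n))).
  by apply: orbit_dist_step; exact: star_lipschitz star _ _ _.
have := expansion_tail 0 be0 a1' deltaA n.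
rewrite add0n {2}/delta subrr normr0 add0r => /le_trans; apply.
by rewrite le_eqVlt; apply/orP; left; apply/eqP; ring.
Qed.

(** The depth [i / m + 1] allowed after [i] steps is small enough to add only a 1/m share of the
    elapsed time to a recovery, and large enough for the excluded radii to be summable. *)
Definition good_base (j : nat) : set (torus R D) :=
  [set theta | forall i, (j <= i)%N ->
    pinch_radius (i %/ m).+1 <= mdist theta (iter i (rotation rho) thetas)].

(* If no [p <= (n - t) %/ m] works, [find] returns [((n - t) %/ m).+1], which
   works on [good_base]. *)
Definition pinch_depth theta n t : nat :=
  find (fun p => pinch_radius p <= mdist (backshift theta (n - t)) thetas)
    (iota 0 ((n - t) %/ m).+1).

Lemma pinch_depth_le theta n t : (pinch_depth theta n t <= ((n - t) %/ m).+1)%N.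
Proof. by rewrite -[leqRHS](size_iota 0) find_size. Qed.

Lemma lt_pinch_depth theta n t p : (p < pinch_depth theta n t)%N ->
  mdist (backshift theta (n - t)) thetas < pinch_radius p.
Proof.
move=> pS; have pn := leq_trans pS (pinch_depth_le theta n t).
by have := before_find 0%N pS; rewrite nth_iota// add0n => /negbT; rewrite -ltNge.
Qed.

Lemma pinch_depthP theta n t j : good_base j theta -> (j <= n - t)%N ->
  pinch_radius (pinch_depth theta n t) <= mdist (backshift theta (n - t)) thetas.
Proof.
move=> gt jt; have := pinch_depth_le theta n t.
rewrite leq_eqVlt => /predU1P[->|lt].
  by rewrite mdist_backshift; exact: gt.
have := @nth_find _ 0%N (fun p => pinch_radius p <=
  mdist (backshift theta (n - t)) thetas) (iota 0 ((n - t) %/ m).+1).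
rewrite has_find size_iota => /(_ lt).
by rewrite nth_iota.
Qed.

Let m22 : 22%:R * (1 + gamma) < gamma * m%:R.
Proof.
have := star_m_large star; rewrite -(ltr_pM2l gamma0); apply: le_lt_trans.
by rewrite le_eqVlt; apply/orP; left; apply/eqP; field; rewrite gt_eqF.
Qed.

Let m6 : (6 <= m)%N.
Proof.
rewrite -(ler_nat R); have := star_m_large star.
have : 0 < gamma^-1 by rewrite invr_gt0.
lra.
Qed.

Let pinched_time theta n := fun t => (0 < workload (pinch_depth theta n) t)%N.

(** Depths after time [u] are at most [P = (n - u) / m + 1], so [sum_levels_le] contributes 4 + 2 =
    6 times the elapsed time and [2 m]; the third [m] comes from [busy_le]. *)
Lemma pinched_time_le theta n N k : (k <= N)%N -> (N <= n)%N ->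
  (m * \sum_(k <= t < N) pinched_time theta n t <= 6 * (n - k) + 3 * m)%N.
Proof.
move=> kN Nn; rewrite (_ : (3 * m = 2 * m + m)%N); last by lia.
rewrite addnA; apply: (@busy_le _ 6) kN => // u uN.
apply: leq_trans (@sum_levels_le _ m u N ((n - u) %/ m).+1 _ _ uN) _.
- move=> p s t us st tN ps pt; apply: (@close_returns (backshift theta n) p s t st).
    by rewrite backshift_add ?lt_pinch_depth//; lia.
  by rewrite backshift_add ?lt_pinch_depth//; lia.
- move=> t /andP[ut tN]; apply: leq_trans (pinch_depth_le _ _ _) _.
  by rewrite ltnS leq_div2r// leq_sub2l.
have := leq_trunc_div (n - u) m; nia.
Qed.

Lemma prod_if (A B : R) (P : pred nat) k N :
  \prod_(k <= i < N) (if P i then A else B) =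
  A ^+ (\sum_(k <= i < N) P i) * B ^+ (\sum_(k <= i < N) ~~ P i).
Proof.
rewrite -!prodrXr -big_split/=; apply: eq_bigr => i _.
by case: (P i); rewrite expr0 expr1 ?mulr1 ?mul1r.
Qed.

(* At most [12 (l + j) / m + 6] of [l] steps are pinched, so the factor over [l]
   steps is at most [alpha] to the power [12 (1 + gamma) l / m - gamma l] up to a
   constant; [m > 22 (1 + 1 / gamma)] makes the first term at most
   [gamma l 12 / 22]. *)
Let q := alpha `^ (- (gamma * (10%:R / 22%:R))).

(** Contraction needs both orbits above [L0], so the pinched times of the two are added. The last
    [j] steps, about which [good_base j] says nothing, cost the factor [alpha ^+ j]. *)
Lemma upper_iterate_lipschitz j : exists L : R, forall n theta theta',
  good_base j theta -> good_base j theta' -> (j <= n)%N ->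
  `|upper_iterate n theta - upper_iterate n theta'| <= L * mdist theta theta'.
Proof.
(* In the exponent, [gamma * j] absorbs the [j] steps separating [N] from [n] in the count of
   pinched times, and [6 * (1 + gamma)] its additive term [6 * m]. *)
pose K := alpha `^ (gamma * j%:R + 6 * (1 + gamma)).
exists (alpha ^+ j * (beta * K / (1 - q) + beta * j%:R)).
move=> n theta theta' gth gth' jn; set e := mdist theta theta'.
pose delta t := `|uval (orbit_top (backshift theta n) t) -
  uval (orbit_top (backshift theta' n) t)|.
pose bad t := pinched_time theta n t || pinched_time theta' n t.
pose N := (n - j)%N.
(* The recurrence is required at every [t], hence the safe rate [alpha] from [N] on; only products
   before [N] are estimated. *)
pose lambda t := if bad t || (N <= t)%N then alpha else alpha `^ (- gamma).
have e0 : 0 <= e by exact: mdist_ge0.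
have beta0 := star_beta star.
have be0 : 0 <= beta * e by rewrite mulr_ge0// ltW.
have alpha1 : 1 < alpha by have := star_alpha star; lra.
have eE : e = mdist (backshift theta n) (backshift theta' n) by rewrite mdist_torusDr.
have deltaA t : delta t.+1 <= alpha * delta t + beta * e.
  by rewrite eE; apply: orbit_dist_step; exact: star_lipschitz star _ _ _.
have deltaL t : delta t.+1 <= lambda t * delta t + beta * e.
  rewrite /lambda; case: ifPn => [_|]; first exact: deltaA.
  rewrite !negb_or -!leqNgt !leqn0 -ltnNge => /andP[/andP[/eqP Y0 /eqP Y0'] tN].
  have Nle theta'' t' : good_base j theta'' -> (t' < N)%N ->
      pinch_radius (pinch_depth theta'' n t') <=
      mdist (backshift theta'' n + proj_torus rho *+ t') thetas.
    move=> gt'' t'N; have [t'n jt'] := before_tail jn t'N.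
    by rewrite backshift_add//; exact: (pinch_depthP gt'').
  have L0le theta'' : good_base j theta'' ->
      workload (pinch_depth theta'' n) t = 0%N ->
      L0 <= uval (orbit_top (backshift theta'' n) t).
    move=> gt'' Yt.
    have := @orbit_top_ge (backshift theta'' n) (pinch_depth theta'' n) N.
    move=> /(_ (fun t' => Nle theta'' t' gt'') t (ltnW tN)).
    by rewrite Yt expr0 invr1 mulr1.
  rewrite eE; apply: orbit_dist_step; apply: (star_contracting star); exact: L0le.
have q0 : 0 < q by rewrite powR_gt0.
have q1 : q < 1.
  have x0 : 0 < gamma * (10%:R / 22%:R) by rewrite mulr_gt0// divr_gt0.
  have := gt0_ltr_powR x0 (ler01 : 1 \in Num.nneg)
    (ltW alpha0 : alpha \in Num.nneg) alpha1.
  by rewrite powR1 /q powRN invf_lt1 ?powR_gt0.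
have deltaN : delta N <= beta * e * K / (1 - q).
  apply: (@contraction_sum _ delta lambda (beta * e) q K N) => //.
  - by rewrite q0.
  - by rewrite /delta subrr normr0.
  - by move=> t; rewrite /lambda; case: ifP => _; rewrite ?powR_ge0 ?ltW.
  move=> k kN; set l := (N - k)%N.
  rewrite (_ : \prod_(k <= i < N) _ =
      \prod_(k <= i < N) (if bad i then alpha else alpha `^ (- gamma))); last first.
    rewrite big_nat [RHS]big_nat; apply: eq_bigr => i /andP[_ iN].
    by rewrite /lambda leqNgt iN orbF.
  rewrite prod_if; set B := (\sum_(k <= i < N) bad i)%N.
  set G := (\sum_(k <= i < N) _)%N.
  have BG : (B + G = l)%N.
    rewrite -big_split/= /l -[RHS]muln1 -[RHS]sum_nat_const_nat.
    by apply: eq_bigr => i _; case: (bad i).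
  have mB : (m * B <= 12 * (l + j) + 6 * m)%N.
    have := pinched_time_le theta kN (leq_subr j n).
    have := pinched_time_le theta' kN (leq_subr j n).
    have : (B <= \sum_(k <= t < N) pinched_time theta n t +
                 \sum_(k <= t < N) pinched_time theta' n t)%N.
      rewrite -big_split/=; apply: leq_sum => i _; rewrite /bad.
      by case: (pinched_time theta n i); case: (pinched_time theta' n i).
    have -> : (n - k = l + j)%N by exact: tail_split.
    rewrite -/N; clear; nia.
  rewrite -(powR_mulrn B (ltW alpha0)) -(powR_mulrn G (powR_ge0 _ _)).
  rewrite -powRrM -powRD; last first.
    by apply/implyP => _; rewrite gt_eqF.
  rewrite /K /q -(powR_mulrn l (powR_ge0 _ _)) -powRrM -powRD; last first.
    by apply/implyP => _; rewrite gt_eqF.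
  apply: ler_powR; first exact: ltW.
  have lE : l%:R = B%:R + G%:R :> R by rewrite -natrD BG.
  have mBR : m%:R * B%:R <= 12%:R * (l%:R + j%:R) + 6%:R * m%:R :> R.
    by rewrite -!natrD -!natrM -natrD ler_nat.
  have mR : 0 < m%:R :> R by rewrite ltr0n.
  suff : (1 + gamma) * B%:R <=
      gamma * (12%:R / 22%:R) * (l%:R + j%:R) + 6%:R * (1 + gamma).
    have j0 : 0 <= gamma * j%:R by rewrite mulr_ge0// ltW.
    rewrite lE; lra.
  rewrite -(ler_pM2l mR) mulrCA.
  have g1 : 0 <= 1 + gamma by rewrite addr_ge0// ltW.
  apply: le_trans (ler_wpM2l g1 mBR) _.
  have lj0 : 0 <= l%:R + j%:R :> R by rewrite addr_ge0.
  have := ler_wpM2r lj0 (ltW m22); lra.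
have := expansion_tail N be0 (ltW alpha1) deltaA j.
rewrite /N subnK// => /le_trans; apply.
rewrite -[leRHS]mulrA; apply: ler_wpM2l; first by rewrite exprn_ge0 ?(ltW alpha0).
have -> : (beta * K / (1 - q) + beta * j%:R) * e =
    beta * e * K / (1 - q) + beta * e * j%:R by ring.
by rewrite lerD2r.
Qed.

End pinched_dynamics.

(** * The upper bounding graph *)

Section borel_maps.
Variables (R : realType).

Lemma lipschitz_borel (X Y : pmetricType R) (f : X -> Y) (L : R) :
  (forall x y, mdist (f x) (f y) <= L * mdist x y) ->
  measurable_fun setT (f : borel X -> borel Y).
Proof.
move=> fL.
apply: (@measurability _ _ (borel X) (borel Y) setT f (@open Y)) => //.
move=> _ [U oU <-]; rewrite setTI; apply: open_borel.
rewrite openE => x /= Ufx.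
have /nbhs_ballP[e /= e0 eU] : nbhs (f x) U by exact: open_nbhs_nbhs.
apply/nbhs_ballP; exists (e / (1 + `|L|)) => /=.
  by rewrite divr_gt0// ltr_wpDr.
move=> y; rewrite ballEmdist/= => xy; apply: eU; rewrite ballEmdist/=.
apply: (le_lt_trans (fL _ _)); apply: (@le_lt_trans _ _ ((1 + `|L|) * mdist x y)).
  by rewrite ler_wpM2r// ?mdist_ge0// (le_trans (ler_norm L))// lerDr.
by rewrite mulrC -ltr_pdivlMr// ltr_wpDr.
Qed.

Lemma inner_part_borel (X : pmetricType R) (U : set X) n :
  measurable (inner_part U n : set (borel X)).
Proof.
rewrite -[inner_part U n]setCK; apply: measurableC; apply: open_borel.
rewrite (_ : ~` _ = \bigcup_(y in ~` U) [set x | mdist y x < n.+1%:R^-1]).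
  by apply: bigcup_open => y _; exact: mdist_open.
apply/seteqP; split=> [x /existsNP[y /not_implyP[Uy /negP]]|x [y Uy /= yx] h].
  by rewrite -ltNge => xy; exists y => //=; rewrite metric_sym.
by have := h _ Uy; rewrite leNgt metric_sym yx.
Qed.

(** The limit lies in an open [U] exactly if the approximants eventually stay in one fixed
    [inner_part U k], a closed set at positive distance from the complement. *)
Lemma measurable_metric_limit d (S : measurableType d) (X : pmetricType R)
    (f_ : nat -> S -> borel X) (f : S -> borel X) :
  (forall n, measurable_fun setT (f_ n)) ->
  (forall s (e : R), 0 < e -> exists N, forall n, (N <= n)%N ->
    mdist (f_ n s : X) (f s) < e) ->
  measurable_fun setT f.
Proof.
move=> mf f_cvg; apply: (@measurability _ _ S (borel X) setT f (@open X)) => //.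
move=> _ [U oU <-]; rewrite setTI.
rewrite (_ : f @^-1` U = \bigcup_k \bigcup_N \bigcap_(n in [set n | (N <= n)%N])
  (f_ n @^-1` (inner_part U k))).
  apply: bigcupT_measurable => k; apply: bigcupT_measurable => N.
  apply: bigcap_measurableType => n _.
  by rewrite -[X in measurable X]setTI; apply: mf => //; exact: inner_part_borel.
apply/seteqP; split => s /=.
  rewrite -{1}(bigcup_inner_part oU) => -[k _ Uk].
  have e0 : 0 < k.+1%:R^-1 - k.+2%:R^-1 :> R.
    by rewrite subr_gt0 ltf_pV2 ?posrE// ltr_nat.
  have [N Ncvg] := f_cvg s _ e0.
  exists k.+1 => //; exists N => // n /= Nn y Uy.
  have := Uk y Uy; have := Ncvg n Nn.
  have := metric_triangle (f s : X) (f_ n s) y; rewrite (metric_sym (f s : X) (f_ n s)).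
  move=> h1 h2 h3; rewrite leNgt; apply/negP => h4.
  have := le_lt_trans h1 (ltrD h2 h4); rewrite subrK => h5.
  by have := le_lt_trans h3 h5; rewrite ltxx.
move=> [k _ [N _ hN]]; apply: contrapT => nU.
have k0 : 0 < k.+1%:R^-1 :> R by rewrite invr_gt0.
have [N' N'cvg] := f_cvg s _ k0.
have := N'cvg (maxn N N') (leq_maxr _ _); rewrite ltNge => /negP; apply.
by apply: (hN (maxn N N') (leq_maxl _ _)).
Qed.

End borel_maps.

Section attractor.
Variables (R : realType) (D : nat) (T : phase R D -> phase R D).
Variables (rho : 'rV[R]_D) (thetas : torus R D).
Hypothesis psp : pinched_skew_product T rho thetas.
Variables (alpha gamma L0 beta c d : R) (m : nat) (a b : R).
Hypothesis star : star_conditions T rho thetas alpha gamma L0 beta c d m a b.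
Implicit Types (theta eta : torus R D) (x y : unit_interval R).

Let clamp_itv (t : R) : Num.max 0 (Num.min 1 t) \in (`[0, 1]%classic : set R).
Proof. by rewrite inE /= in_itv/= le_max lexx ge_max ler01 ge_min lexx. Qed.

Definition clamp (t : R) : unit_interval R :=
  exist _ (Num.max 0 (Num.min 1 t)) (clamp_itv t).

Lemma uval_clamp t : 0 <= t <= 1 -> uval (clamp t) = t.
Proof. by move=> /andP[t0 t1]; rewrite /uval /= (min_idPr t1) (max_idPr t0). Qed.

Lemma uvalK x : clamp (uval x) = x.
Proof. by apply/val_inj; exact: uval_clamp (uval_itv x). Qed.

Lemma clamp_lipschitz (s t : R) :
  `|uval (clamp s) - uval (clamp t)| <= `|s - t|.
Proof.
have := ler_norm (s - t); have := ler_norm (t - s); rewrite (distrC t).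
rewrite /uval/= ler_norml; move: `|s - t| => n h1 h2.
have m01 : Num.max 0 1 = 1 :> R by exact: (max_idPr ler01).
case: (lerP 1 s) => hs; [rewrite m01|case: (lerP 0 s) => hs0];
  (case: (lerP 1 t) => ht; [rewrite m01|case: (lerP 0 t) => ht0]); lra.
Qed.

(** Intermediate values between the fixed height 0 and the height of [y]; [clamp] extends the fibre
    map to the real line for this purpose. *)
Lemma fibre_map_surj theta x y : uval x <= uval (fibre_map T theta y) ->
  exists2 z, uval z <= uval y & fibre_map T theta z = x.
Proof.
move=> xy; pose f t := uval (fibre_map T theta (clamp t)).
have /andP[y0 y1] := uval_itv y; have /andP[x0 x1] := uval_itv x.
have a0 : 0 < alpha by have := star_alpha star; lra.
have cf : continuous f.
  move=> s; apply/cvgrPdist_lt => e e0.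
  near=> t; rewrite /f (le_lt_trans (star_lipschitz star _ _ _))//.
  rewrite -ltr_pdivlMl// (le_lt_trans (clamp_lipschitz _ _))//.
  near: t; apply: cvgr_dist_lt => //; rewrite mulr_gt0// invr_gt0//.
have f0 : f 0 = 0.
  by apply: (psp_zero psp); rewrite uval_clamp// lexx ler01.
have fy : f (uval y) = uval (fibre_map T theta y) by rewrite /f uvalK.
have [|t] := @IVT _ f 0 (uval y) (uval x) y0 (continuous_subspaceT cf).
  rewrite f0 fy ge_min x0/= le_max xy orbT//.
rewrite in_itv/= => /andP[t0 ty] ft.
exists (clamp t); first by rewrite uval_clamp// t0 (le_trans ty).
exact/val_inj.
Unshelve. all: by end_near. Qed.

Lemma iter_fibre_le n theta x y : uval x <= uval y ->
  uval (iter n T (theta, x)).2 <= uval (iter n T (theta, y)).2.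
Proof.
move=> xy; elim: n => // n IHn; rewrite !iterS.
rewrite (surjective_pairing (iter n T (theta, x))).
rewrite (surjective_pairing (iter n T (theta, y))) !(iter_base psp).
exact: (psp_monotone psp).
Qed.

Lemma le_unit_top x : uval x <= uval (unit_top R).
Proof. by have /andP[] := uval_itv x. Qed.

Lemma backshiftD theta n k :
  backshift rho (backshift rho theta n) k = backshift rho theta (n + k).
Proof. by rewrite /backshift mulrnDr opprD addrA. Qed.

(** With [upper_iterate_ub] this shows that the n-th image of the phase space is the region below
    the n-th image of the top curve. *)
Lemma upper_iterate_surj n theta x : uval x <= upper_iterate T rho n theta ->
  exists p, iter n T p = (theta, x).
Proof.
elim: n theta x => [|n IHn] theta x; first by exists (theta, x).
rewrite /upper_iterate (orbit_topS psp) backshift_add// subSnn.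
move=> /fibre_map_surj[z].
rewrite -[n.+1]add1n -backshiftD => zle zx.
have [p pE] := IHn _ _ zle.
exists p; rewrite iterS pE (skewE psp) zx; congr pair.
by rewrite /backshift mulr1n subrK.
Qed.

Lemma upper_iterate_ub n theta x : (iter n T @` setT) (theta, x) ->
  uval x <= upper_iterate T rho n theta.
Proof.
move=> [[eta y] _ pE].
have etaE : eta = backshift rho theta n.
  have := iter_base psp n (eta, y); rewrite pE /= => ->.
  by rewrite /backshift addrK.
rewrite /upper_iterate /orbit_top -etaE.
have -> : x = (iter n T (eta, y)).2 by rewrite pE.
by apply: iter_fibre_le; exact: le_unit_top.
Qed.

Lemma upper_iterate_itv n theta : 0 <= upper_iterate T rho n theta <= 1.
Proof. exact: uval_itv. Qed.

Lemma upper_iterate_ni theta :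
  nonincreasing_seq (fun n => upper_iterate T rho n theta).
Proof.
apply/nonincreasing_seqP => n.
rewrite /upper_iterate /orbit_top iterSr (skewE psp).
rewrite (_ : backshift rho theta n.+1 + _ = backshift rho theta n); last first.
  by rewrite -[proj_torus rho]mulr1n backshift_add// subn1.
by apply: iter_fibre_le; exact: le_unit_top.
Qed.

Lemma global_attractorP theta x : global_attractor T (theta, x) <->
  forall n, uval x <= upper_iterate T rho n theta.
Proof.
split=> [Ax n|xle n _]; last first.
  by have [p pE] := upper_iterate_surj (xle n); exists p.
(* The attractor intersects images from [n = 1] on; monotonicity in [n] covers the index 0. *)
apply: (@le_trans _ _ (upper_iterate T rho n.+1 theta)).
  by apply: upper_iterate_ub; exact: Ax.
exact: upper_iterate_ni.
Qed.

Let range_lb theta : lbound (range (fun n => upper_iterate T rho n theta)) 0.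
Proof. by move=> _ [n _ <-]; have /andP[] := upper_iterate_itv n theta. Qed.

Lemma upper_bounding_graphE theta : upper_bounding_graph T theta =
  inf (range (fun n => upper_iterate T rho n theta)).
Proof.
set h := range _.
have hl : has_inf h.
  by split; [exists (upper_iterate T rho 0 theta), 0%N|exists 0; exact: range_lb].
have h0 : 0 <= inf h by apply: lb_le_inf; [exact: hl.1|exact: range_lb].
have hle n : inf h <= upper_iterate T rho n theta.
  by apply: inf_lbound; [exact: hl.2|exists n].
have h1 : inf h <= 1.
  by apply: (le_trans (hle 0)); have /andP[] := upper_iterate_itv 0 theta.
have hE : uval (clamp (inf h)) = inf h by rewrite uval_clamp// h0.
apply/eqP; rewrite eq_le; apply/andP; split.
  apply: ge_sup.
    exists (inf h), (clamp (inf h)) => //=.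
    by apply/global_attractorP => n; rewrite hE.
  move=> _ [x /= /global_attractorP xle <-].
  by apply: lb_le_inf; [exact: hl.1|move=> _ [n _ <-]].
apply: ub_le_sup.
  by exists 1 => _ [x _ <-]; have /andP[] := uval_itv x.
exists (clamp (inf h)) => //=.
by apply/global_attractorP => n; rewrite hE.
Qed.

Lemma upper_iterate_cvg theta :
  upper_iterate T rho n theta @[n --> \oo] --> upper_bounding_graph T theta.
Proof.
rewrite upper_bounding_graphE; apply: nonincreasing_cvgn.
  exact: upper_iterate_ni.
by exists 0; exact: range_lb.
Qed.

Lemma upper_bounding_graph_itv theta : 0 <= upper_bounding_graph T theta <= 1.
Proof.
rewrite -(cvg_lim _ (@upper_iterate_cvg theta))//.
have c_ : cvgn (fun n => upper_iterate T rho n theta).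
  by apply/cvg_ex; eexists; exact: upper_iterate_cvg.
rewrite limr_ge//=; last by near=> n; have /andP[] := upper_iterate_itv n theta.
by rewrite limr_le//=; near=> n; have /andP[] := upper_iterate_itv n theta.
Unshelve. all: by end_near. Qed.

Lemma upper_bounding_graph_lipschitz j : exists2 L : R, 0 <= L &
  forall theta theta', good_base rho thetas m a b j theta ->
  good_base rho thetas m a b j theta' ->
  `|upper_bounding_graph T theta - upper_bounding_graph T theta'|
    <= L * mdist theta theta'.
Proof.
have [L HL] := upper_iterate_lipschitz psp star j.
exists `|L| => // theta theta' gt gt'.
have h : `|upper_iterate T rho n theta - upper_iterate T rho n theta'| @[n --> \oo]
    --> `|upper_bounding_graph T theta - upper_bounding_graph T theta'|.
  by apply: cvg_norm; apply: cvgB; exact: upper_iterate_cvg.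
rewrite -(cvg_lim _ h)//; apply: limr_le.
  by apply/cvg_ex; eexists; exact: h.
near=> n; apply: (le_trans (HL n theta theta' gt gt' _)).
  by near: n; exact: nbhs_infty_ge.
by rewrite ler_wpM2r ?mdist_ge0// ler_norm.
Unshelve. all: by end_near. Qed.

Definition graph_map theta : phase R D :=
  (theta, clamp (upper_bounding_graph T theta)).

Lemma graph_setP p : graph_set (upper_bounding_graph T) p <-> graph_map p.1 = p.
Proof.
case: p => theta x; rewrite /graph_set /graph_map /=; split=> [xE|[] <-].
  by rewrite -xE uvalK.
by rewrite uval_clamp// upper_bounding_graph_itv.
Qed.

(** Projecting the part of [B] on the graph is pulling [B] back by [graph_map], so the graph measure
    is a push-forward and inherits countable additivity. *)
Lemma graph_measureE (B : set (phase R D)) :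
  graph_measure (upper_bounding_graph T) B = lebesgue_torus (graph_map @^-1` B).
Proof.
congr lebesgue_torus; apply/seteqP; split=> [_ [p [Bp /graph_setP pE] <-]|theta Btheta].
  by rewrite /= pE.
by exists (graph_map theta) => //; split => //; apply/graph_setP.
Qed.

(** A decreasing limit of continuous curves need not be continuous, but it is a pointwise limit of
    Lipschitz ones. *)
Lemma measurable_graph_map :
  measurable_fun setT (graph_map : borel (torus R D) -> borel (phase R D)).
Proof.
pose f_ n theta : phase R D := (theta, clamp (upper_iterate T rho n theta)).
apply: (@measurable_metric_limit _ _ (borel (torus R D)) (phase R D) f_).
  move=> n; have [L HL] := upper_iterate_lipschitz_at psp star n.
  apply: (@lipschitz_borel _ (torus R D) (phase R D) _ (1 + `|L|)) => theta theta'.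
  rewrite /mdist/= /prod_dist/= ge_max; apply/andP; split.
    by rewrite ler_peMl ?mdist_ge0// lerDl.
  apply: (le_trans (clamp_lipschitz _ _)); apply: (le_trans (HL _ _)).
  by rewrite ler_wpM2r ?mdist_ge0// (le_trans (ler_norm _))// lerDr.
move=> theta e e0; have /cvgrPdist_lt/(_ _ e0)[N _ HN] := @upper_iterate_cvg theta.
exists N => n Nn; rewrite /mdist/= /prod_dist/= mdistxx gt_max e0/=.
apply: (le_lt_trans (clamp_lipschitz _ _)); rewrite distrC.
exact: HN.
Qed.

End attractor.

Lemma geometric_sum_le (R : realType) (q : R) n : 0 <= q < 1 ->
  \sum_(0 <= i < n) q ^+ i <= (1 - q)^-1.
Proof.
move=> /andP[q0 q1]; have q1' : 0 < 1 - q by rewrite subr_gt0.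
rewrite -(ler_pM2l q1') mulfV ?gt_eqF// big_mkord -opprB mulNr -subrX1 opprB.
by rewrite gerBl exprn_ge0.
Qed.

(** * Measure of the excluded part of the base *)

Section good_base_measure.
Variables (R : realType) (D : nat).
Hypothesis D_gt0 : (0 < D)%N.
Variables (rho : 'rV[R]_D) (thetas : torus R D) (m : nat) (a b : R).
Hypotheses (m_gt0 : (0 < m)%N) (a_gt1 : 1 < a) (b01 : 0 < b < 1).
Variable P : probability (borel (torus R D)) R.
Hypothesis PE :
  forall B : set (borel (torus R D)), measurable B -> P B = lebesgue_torus B.

Let tau i := iter i (rotation rho) thetas.
Let r i : R := pinch_radius a b (i %/ m).+1.

Let good_baseE j : good_base rho thetas m a b j =
  ~` \bigcup_(i in ~` `I_j) [set theta | mdist (tau i) theta < r i].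
Proof.
apply/seteqP; split=> [theta gt [i /= /negP ij]|theta gt i ji].
  by rewrite metric_sym ltNge gt// leqNgt.
rewrite leNgt; apply/negP => lt; apply: gt; exists i => /=.
  by apply/negP; rewrite -leqNgt.
by rewrite metric_sym.
Qed.

Lemma good_base_borel j :
  measurable (good_base rho thetas m a b j : set (borel (torus R D))).
Proof.
rewrite good_baseE; apply: measurableC; apply: bigcup_measurable => i _.
exact: mdist_ball_borel.
Qed.

(** A geometric rate for the excluded radii: [i %/ m + 1] is at least [i / m]. *)
Let s := a `^ (- m%:R^-1).

Let s0 : 0 < s. Proof. by rewrite powR_gt0// (lt_trans _ a_gt1). Qed.

Let s1 : s < 1.
Proof.
rewrite /s powRN invf_lt1 ?powR_gt0 ?(lt_trans _ a_gt1)//.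
have x0 : 0 < m%:R^-1 :> R by rewrite invr_gt0 ltr0n.
have a0 : 0 <= a by rewrite ltW// (lt_trans _ a_gt1).
have := gt0_ltr_powR x0 (ler01 : 1 \in Num.nneg) (a0 : a \in Num.nneg) a_gt1.
by rewrite powR1.
Qed.

Let r_le i : r i <= s ^+ i.
Proof.
have a0 : 0 < a by rewrite (lt_trans _ a_gt1).
have /andP[b0 b1] := b01.
apply: (@le_trans _ _ (a ^- (i %/ m).+1)).
  by rewrite ler_piMl ?invr_ge0 ?exprn_ge0 ?(ltW a0)//; lra.
rewrite -powR_invn ?(ltW a0)// -(powR_mulrn _ (ltW s0)) /s -powRrM.
apply: ler_powR; first exact: ltW.
rewrite mulNr lerN2 ler_pdivrMl ?ltr0n// -natrM ler_nat.
by rewrite mulnC ltnW// ltn_ceil.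
Qed.

Let r0 i : 0 < r i.
Proof.
have /andP[b0 _] := b01.
by rewrite mulr_gt0 ?divr_gt0// invr_gt0 exprn_gt0// (lt_trans _ a_gt1).
Qed.

Let ball_le i :
  (P [set theta | (mdist (tau i) theta < r i)%R] <= (6 ^+ D * s ^+ i)%:E)%E.
Proof.
apply: (le_trans (torus_ball_le PE _ (ltW (r0 i)))).
rewrite lee_fin exprMn ler_wpM2l ?exprn_ge0//.
(* Radii are at most 1 and [D > 0], so their D-th power is bounded by the radius itself. *)
apply: le_trans (r_le i); rewrite -[leRHS]expr1 ler_wiXn2l ?(ltW (r0 i))//.
by rewrite (le_trans (r_le i))// exprn_ile1// ltW.
Qed.

Let sum_lty : (\sum_(i <oo) (6 ^+ D * s ^+ i)%:E < +oo)%E.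
Proof.
apply: (@le_lt_trans _ _ (6 ^+ D / (1 - s))%:E); last exact: ltry.
apply: lime_le.
  by apply: is_cvg_nneseries => n _ _; rewrite lee_fin mulr_ge0 ?exprn_ge0 ?(ltW s0).
near=> n; rewrite sumEFin lee_fin -mulr_sumr ler_wpM2l ?exprn_ge0//.
by apply: geometric_sum_le; rewrite (ltW s0) s1.
Unshelve. all: by end_near. Qed.

Lemma good_base_small (e : R) : 0 < e ->
  exists j, (P (~` good_base rho thetas m a b j) <= e%:E)%E.
Proof.
move=> e0.
have ge0 i : (0 <= (6 ^+ D * s ^+ i)%:E)%E.
  by rewrite lee_fin mulr_ge0 ?exprn_ge0 ?(ltW s0).
have tail := nneseries_tail_cvg sum_lty (fun i _ => ge0 i).
have [N _ HN] := tail _ (open_ereal_lt' (e0 : 0 < e%:E)%E).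
exists N; apply: le_trans (ltW (HN N (leqnn N))); rewrite good_baseE setCK.
have mball i : measurable ([set theta | mdist (tau i) theta < r i] :
    set (borel (torus R D))) by exact: mdist_ball_borel.
apply: (@le_trans _ _ (\sum_(N <= n <oo)
    P [set theta | (mdist (tau n) theta < r n)%R])%E).
  by apply: measure_sigma_subadditive_tail => //; exact: bigcup_measurable.
by apply: lee_nneseries => [i _ _|i _]; [exact: measure_ge0|exact: ball_le].
Qed.

Let full_base := \bigcup_j good_base rho thetas m a b j.

Lemma full_base_borel : measurable (full_base : set (borel (torus R D))).
Proof. by apply: bigcup_measurable => j _; exact: good_base_borel. Qed.

Lemma full_base_null : P (~` full_base) = 0%E.
Proof.
apply/eqP; rewrite eq_le measure_ge0 andbT; apply/lee_addgt0Pr => e e0.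
rewrite add0e; have [j Pj] := good_base_small e0; apply: le_trans Pj.
apply: le_measure; rewrite ?inE.
- by apply: measurableC; exact: full_base_borel.
- by apply: measurableC; exact: good_base_borel.
- by apply: subsetC => x gx; exists j.
Qed.

Lemma torus_set1_null p : P [set p] = 0%E.
Proof.
apply/eqP; rewrite eq_le measure_ge0 andbT; apply/lee_addgt0Pr => e e0.
rewrite add0e; pose x := Num.min 1 e / 6.
have x0 : 0 < x by rewrite divr_gt0// lt_min ltr01.
apply: (@le_trans _ _ (P [set q | mdist p q < x])).
  apply: le_measure; rewrite ?inE; last by move=> _ ->; rewrite /= mdistxx.
    exact: set1_borel.
  exact: mdist_ball_borel.
apply: (le_trans (torus_ball_le PE p (ltW x0))).
rewrite lee_fin /x [6 * _]mulrC divfK//.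
have [n ->] : exists n, D = n.+1 by case: (D) D_gt0 => // n _; exists n.
rewrite exprS; apply: (@le_trans _ _ (Num.min 1 e)); last by rewrite ge_min lexx orbT.
by rewrite ler_piMr ?exprn_ile1// ?ge_min ?lexx// le_min ler01 ltW.
Qed.

End good_base_measure.

(** * Rectifiability *)

Local Open Scope ereal_scope.

Lemma lee_expe (R : realType) (x y : \bar R) n :
  0 <= x -> x <= y -> x ^+ n <= y ^+ n.
Proof.
move=> x0 xy; elim: n => [|n IHn]; first by rewrite !expe0.
by rewrite !expeS lee_pmul// expe_ge0.
Qed.

(** The finite cover is enumerated and padded with empty sets, which cost nothing since [s > 0]. *)
Lemma hausdorff_content_finite_cover (R : realType) (X : pmetricType R) (s : nat)
    (fT : finType) (F : fT -> set X) (A : set X) (c e : R) : (0 < s)%N ->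
  (0 <= c <= e)%R -> A `<=` \bigcup_z F z -> (forall z, diam (F z) <= c%:E) ->
  hausdorff_content s e A <= (#|fT|%:R * c ^+ s)%:E.
Proof.
move=> s0 /andP[c0 ce] AF Fc.
pose K := #|fT|.
pose H (i : nat) := if insub i is Some k then F (@enum_val fT fT k) else set0.
have dH i : diam (H i) <= c%:E.
  by rewrite /H; case: insubP => // _; rewrite diam0 lee_fin.
apply: (@le_trans _ _ (\sum_(i <oo) diam (H i) ^+ s)).
  apply: ereal_inf_lbound; exists H => //; split => [x /AF[z _ Fzx]|i].
    exists (enum_rank z) => //; rewrite /H insubT//= => lt.
    by rewrite (_ : Sub _ _ = enum_rank z) ?enum_rankK//; exact/val_inj.
  by rewrite (le_trans (dH i))// lee_fin.
have dHs i : diam (H i) ^+ s <= (c ^+ s)%:E.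
  by rewrite EFin_expe lee_expe// diam_ge0.
have dH0 i : (K <= i)%N -> diam (H i) ^+ s = 0.
  move=> Ki; rewrite /H insubF; last by rewrite ltnNge Ki.
  by rewrite diam0; case: (s) s0 => // n _; rewrite expeS mul0e.
apply: lime_le.
  by apply: is_cvg_nneseries => n _ _; rewrite expe_ge0 ?diam_ge0.
near=> n.
have Kn : (K <= n)%N by near: n; exact: nbhs_infty_ge.
rewrite (big_cat_nat _ (n := K))//=.
have -> : \sum_(K <= i < n) diam (H i) ^+ s = 0.
  by rewrite big_nat big1// => i /andP[Ki _]; exact: dH0.
rewrite adde0.
rewrite big_mkord; apply: (@le_trans _ _ (\sum_(i < K) (c ^+ s)%:E)).
  by apply: lee_sum => i _; exact: dHs.
by rewrite sumEFin lee_fin sumr_const card_ord mulr_natl.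
Unshelve. all: by end_near. Qed.

Section torus_grid.
Variables (R : realType) (D : nat).

Definition torus_cell (N : nat) (z : {ffun 'I_D -> 'I_N.+1}) : set (torus R D) :=
  @proj_torus R D @` grid_cell N [ffun i => (z i : nat)%:Z].

Lemma torus_cell_cover N (p : torus R D) : exists z, torus_cell (N := N) z p.
Proof.
have [v [v01 vp]] := torus_lift p.
have h i : (`|Num.floor (v 0%R i * N.+1%:R)|%N < N.+1)%N.
  have /andP[v0 v1] := v01 i.
  have f0 : (0 <= Num.floor (v 0%R i * N.+1%:R))%R by rewrite floor_ge0 mulr_ge0.
  have : (Num.floor (v 0%R i * N.+1%:R) < N.+1%:Z)%R.
    by rewrite floor_lt_int -[X in (_ < X)%R]mul1r ltr_pM2r.
  by rewrite -{1}(gez0_abs f0).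
exists [ffun i => Ordinal (h i)]; exists v => //= i; rewrite !ffunE/= gez0_abs//.
by rewrite floor_ge0 mulr_ge0//; have /andP[] := v01 i.
Qed.

Lemma torus_cell_mdist N z p q : torus_cell (N := N) z p -> torus_cell z q ->
  (mdist p q <= D%:R / N.+1%:R)%R.
Proof.
move=> [u uz <-] [v vz <-]; apply: (le_trans (mdist_proj_le _ _)).
exact: grid_cell_enorm uz vz.
Qed.

Lemma mdist_fst_le (p q : phase R D) : (mdist p.1 q.1 <= mdist p q)%R.
Proof. by rewrite [leRHS]/mdist/= /prod_dist le_max lexx. Qed.

Lemma measurable_fst_phase :
  measurable_fun setT (fst : borel (phase R D) -> borel (torus R D)).
Proof.
apply: (@lipschitz_borel _ (phase R D) (torus R D) _ 1%R) => p q.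
by rewrite mul1r mdist_fst_le.
Qed.

End torus_grid.

Section rectifiable_graph.
Variables (R : realType) (D : nat).
Hypothesis D_gt0 : (0 < D)%N.
Variable P : probability (borel (torus R D)) R.
Hypothesis P_ball : forall (p : torus R D) (r : R), (0 <= r)%R ->
  P [set q | (mdist p q < r)%R] <= ((6 * r) ^+ D)%:E.
Hypothesis P_point : forall p : torus R D, P [set p] = 0.
Variable G : torus R D -> phase R D.
Hypothesis G1 : forall theta, (G theta).1 = theta.
Hypothesis mG : measurable_fun setT (G : borel (torus R D) -> borel (phase R D)).
Hypothesis graph_borel :
  measurable ([set p | G p.1 = p] : set (borel (phase R D))).
Variable Omega : nat -> set (torus R D).
Hypothesis Omega_borel :
  forall j, measurable (Omega j : set (borel (torus R D))).
Hypothesis Omega_lipschitz : forall j, exists2 L : R, (0 <= L)%R &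
  forall theta theta', Omega j theta -> Omega j theta' ->
  (mdist (G theta) (G theta') <= L * mdist theta theta')%R.
Hypothesis Omega_full : P (~` \bigcup_j Omega j) = 0.

(** The images of the [N.+1 ^ D] grid cells have diameter at most [L * D / N.+1], so their sum is
    bounded by the same [(L * D) ^ D] at every scale. *)
Lemma hausdorff_graph_lty j : hausdorff D (G @` Omega j) < +oo.
Proof.
have [L L0 HL] := Omega_lipschitz j.
apply: (@le_lt_trans _ _ ((L * D%:R) ^+ D)%:E); last exact: ltry.
rewrite hausdorffE; apply: ge_ereal_sup => _ [e + <-].
rewrite /= in_itv/= andbT => e0.
pose N := Num.truncn (L * D%:R / e).
pose c : R := (L * (D%:R / N.+1%:R))%R.
have c0 : (0 <= c)%R by rewrite mulr_ge0// divr_ge0.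
have ce : (c <= e)%R.
  rewrite /c mulrA ler_pdivrMr// [leRHS]mulrC -ler_pdivrMr// ltW//.
  exact: truncnS_gt.
pose F (z : {ffun 'I_D -> 'I_N.+1}) := G @` (Omega j `&` torus_cell z).
apply: (@le_trans _ _ (#|{ffun 'I_D -> 'I_N.+1}|%:R * c ^+ D)%:E).
  apply: (@hausdorff_content_finite_cover _ _ _ _ F) => //; first by rewrite c0.
    move=> _ [theta Otheta <-]; have [z zt] := torus_cell_cover N theta.
    by exists z => //; exists theta.
  move=> z; apply: diam_le => // _ _ [t [Ot zt] <-] [t' [Ot' zt'] <-].
  by rewrite (le_trans (HL _ _ Ot Ot'))// ler_wpM2l// (torus_cell_mdist zt zt').
rewrite lee_fin card_ffun !card_ord natrX -exprMn /c.
rewrite le_eqVlt; apply/orP; left; apply/eqP; congr (_ ^+ _)%R.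
by field.
Qed.

(** Sets of a Hausdorff cover may be non-measurable, so the projection is enclosed in a ball of
    twice the diameter, whence 12 = 6 * 2. Diameter 0 is separate: an open ball of radius 0 would be
    empty. *)
Lemma small_borel_hull (F : set (phase R D)) : diam F <= 1 ->
  exists U : set (borel (torus R D)), [/\ measurable U,
    fst @` F `<=` U & P U <= (12 ^+ D)%:E * diam F ^+ D].
Proof.
move=> F1; have [->|/set0P[p Fp]] := eqVneq F set0.
  exists set0; rewrite image_set0 measure0; split => //.
  by rewrite mule_ge0 ?expe_ge0 ?diam_ge0.
have Ffin : diam F \is a fin_num.
  by rewrite ge0_fin_numE ?diam_ge0// (le_lt_trans F1) ?ltry.
have dF x y : F x -> F y -> (mdist x.1 y.1 <= fine (diam F))%R.
  move=> Fx Fy; apply: (le_trans (mdist_fst_le _ _)).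
  by rewrite -lee_fin fineK// mdist_le_diam.
have d0 : (0 <= fine (diam F))%R by rewrite fine_ge0 ?diam_ge0.
move: d0; rewrite le_eqVlt => /predU1P[d0|d0].
  exists [set p.1]; split.
  - exact: set1_borel.
  - move=> _ [q Fq <-] /=; apply/esym/mdist_positivity/eqP.
    by rewrite eq_le mdist_ge0 andbT d0 dF.
  - by rewrite P_point mule_ge0 ?expe_ge0 ?diam_ge0.
exists [set q | (mdist p.1 q < 2 * fine (diam F))%R]; split.
- exact: mdist_ball_borel.
- by move=> _ [q Fq <-] /=; rewrite (le_lt_trans (dF _ _ Fp Fq))// ltr_pMl// ltr1n.
- apply: (le_trans (P_ball _ _)); first by rewrite mulr_ge0// ltW.
  rewrite -[X in _ <= _ * X ^+ _]fineK// -EFin_expe -EFinM lee_fin.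
  by rewrite mulrA exprMn (_ : 6 * 2 = 12)%R// -natrM.
Qed.

Lemma hausdorff_null_projection (B : set (phase R D)) : hausdorff D B = 0 ->
  exists2 U : set (borel (torus R D)), measurable U & fst @` B `<=` U /\ P U = 0.
Proof.
move=> B0; suff small n : exists2 U : set (borel (torus R D)),
    measurable U & fst @` B `<=` U /\ P U <= (n.+1%:R^-1)%:E.
  have [U UP] := choice (fun n => let: ex_intro2 U mU UB := small n in
    ex_intro (fun U => measurable U /\ _) U (conj mU UB)).
  exists (\bigcap_n U n); first by apply: bigcapT_measurable => n; exact: (UP n).1.
  split; first by move=> x Bx n _; exact: (UP n).2.1.
  apply/eqP; rewrite eq_le measure_ge0 andbT; apply/lee_addgt0Pr => e e0.
  rewrite add0e; apply: (@le_trans _ _ (P (U (Num.truncn e^-1)))).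
    apply: le_measure; rewrite ?inE; last exact: bigcap_inf.
      by apply: bigcapT_measurable => n; exact: (UP n).1.
    exact: (UP _).1.
  apply: (le_trans (UP _).2.2); rewrite lee_fin ltW//.
  by rewrite invf_plt ?posrE// truncnS_gt.
have c0 : hausdorff_content D 1 B = 0.
  apply/eqP; rewrite eq_le hausdorff_content_ge0 andbT -B0.
  exact: hausdorff_content_le_hausdorff.
pose e : R := (n.+1%:R^-1 / 12 ^+ D)%R.
have e0 : (0 < e)%R by rewrite divr_gt0 ?invr_gt0 ?exprn_gt0.
have [_ [F [BF F1] <-]] : exists2 y, [set \sum_(i <oo) diam (F i) ^+ D |
    F in [set F : nat -> set (phase R D) | B `<=` \bigcup_i F i /\
    forall i, diam (F i) <= 1%:E]] y & y < e%:E.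
  by apply: ereal_inf_lt; rewrite -/(hausdorff_content D 1 B) c0 lte_fin.
move=> Fe; have [U UP] := choice (fun i => small_borel_hull (F1 i)).
exists (\bigcup_i U i).
  by apply: bigcup_measurable => i _; have [] := UP i.
split.
  move=> _ [p /BF[i _ Fip] <-]; exists i => //.
  by have [_ + _] := UP i; apply; exists p.
apply: (@le_trans _ _ (\sum_(i <oo) P (U i))).
  apply: measure_sigma_subadditive => //.
    by move=> i; have [] := UP i.
  by apply: bigcup_measurable => i _; have [] := UP i.
apply: (@le_trans _ _ (\sum_(i <oo) (12 ^+ D)%:E * diam (F i) ^+ D)).
  by apply: lee_nneseries => [i _ _|i _]; [exact: measure_ge0|have [] := UP i].
rewrite nneseriesZl; last by move=> i _; rewrite expe_ge0 ?diam_ge0.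
apply: (le_trans (lee_wpmul2l _ (ltW Fe))); first by rewrite lee_fin exprn_ge0.
by rewrite -EFinM lee_fin /e mulrCA mulfV ?mulr1// gt_eqF// exprn_gt0.
Qed.

Let GM : {mfun borel (torus R D) >-> borel (phase R D)} :=
  HB.pack (G : borel (torus R D) -> borel (phase R D))
    (isMeasurableFun.Build _ _ _ _ _ mG).

Let M := distribution P GM.

(** The union of the Lipschitz pieces, written by an equation and a preimage rather than as an
    image, so that it is visibly Borel. *)
Let A : set (borel (phase R D)) :=
  [set p | G p.1 = p] `&` fst @^-1` \bigcup_j Omega j.

Let mA : measurable A.
Proof.
apply: measurableI => //; rewrite -[X in measurable X]setTI.
by apply: measurable_fst_phase => //; apply: bigcup_measurable => j _; exact: Omega_borel.
Qed.

Let A_null (B : set (borel (phase R D))) :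
  measurable B -> hausdorff D (B `&` A) = 0 -> M B = 0.
Proof.
move=> mB /hausdorff_null_projection[U mU [BU U0]].
have mO : measurable (~` \bigcup_j Omega j : set (borel (torus R D))).
  by apply: measurableC; apply: bigcup_measurable => j _; exact: Omega_borel.
apply/eqP; rewrite eq_le measure_ge0 andbT; change (P (G @^-1` B) <= 0).
apply: (@le_trans _ _ (P (U `|` ~` \bigcup_j Omega j))).
  apply: le_measure; rewrite ?inE.
  - by rewrite -[X in measurable X]setTI; apply: mG.
  - exact: measurableU.
  - move=> theta /= BG; have [Ot|nO] := pselect ((\bigcup_j Omega j) theta).
      left; apply: BU; exists (G theta); last exact: G1.
      by split => //; split => /=; rewrite ?G1.
    by right.
apply: (@le_trans _ _ (P U + P (~` \bigcup_j Omega j))).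
  exact: measureU2.
by rewrite U0 Omega_full adde0.
Qed.

(** Each piece has finite Hausdorff measure, so the restriction to [A] is sigma-finite; by [A_null]
    it dominates the push-forward, and the density is the Radon-Nikodym derivative. *)
Lemma graph_rectifiable : exists (A : set (phase R D))
    (Theta : borel (phase R D) -> R),
  [/\ countably_rectifiable D A,
      measurable_fun (A : set (borel (phase R D))) Theta,
      (forall x, A x -> (0 <= Theta x)%R) &
      forall B : set (borel (phase R D)), measurable B ->
        P (G @^-1` B) = \int[(hausdorff D :
            set (borel (phase R D)) -> \bar R)]_(x in A `&` B) (Theta x)%:E].
Proof.
have [H HE] := hausdorff_borel (phase R D) D_gt0.
have HEE B : H B = hausdorff D B by rewrite -HE.
pose A_ j : set (phase R D) := G @` Omega j.
have AE j : A_ j = [set p | G p.1 = p] `&` fst @^-1` Omega j.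
  apply/seteqP; split=> [_ [theta Ot <-]|p [/= Gp Op]]; first by rewrite /= !G1.
  by exists p.1.
have mA_ j : measurable (A_ j : set (borel (phase R D))).
  rewrite AE; apply: measurableI => //; rewrite -[X in measurable X]setTI.
  exact: measurable_fst_phase.
have AU : A = \bigcup_j A_ j.
  by under eq_bigcupr do rewrite AE; rewrite /A preimage_bigcup setI_bigcupr.
pose HA : set (borel (phase R D)) -> \bar R := mrestr H mA.
have HA_sigma : sigma_finite setT HA.
  (* The restricted measure vanishes off [A], so the complement can be joined to every piece to
     cover the whole space. *)
  exists (fun j => ~` A `|` A_ j).
    apply/seteqP; split => // p _; have [Ap|nA] := pselect (A p).
      by move: Ap; rewrite {1}AU => -[j _ Aj]; exists j => //; right.
    by exists 0%N => //; left.
  move=> j; have mAj : measurable (~` A `|` A_ j : set (borel (phase R D))).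
    by apply: measurableU => //; exact: measurableC.
  split => //; rewrite /HA /mrestr HEE setIUl setICl set0U.
  apply: le_lt_trans (hausdorff_graph_lty j).
  by apply: le_hausdorff => ? [].
pose nu : {sigma_finite_measure set (borel (phase R D)) -> \bar R} :=
  HB.pack HA (Measure.on (mrestr H mA))
    (Measure_isSigmaFinite.Build _ _ _ HA HA_sigma).
have dom : M `<< nu.
  move=> N N0 B mB BN; apply: A_null => //.
  by have := N0 B mB BN; rewrite /= /HA /mrestr HEE.
have [f [f0 ffin /integrableP[mf _] fE]] := radon_nikodym_sigma_finite dom.
exists A, (fine \o f); split.
- split => //; exists (fun j => [set v | Omega j (proj_torus v)]).
  exists (fun j v => G (proj_torus v)); split.
    move=> j; have [L L0 HL] := Omega_lipschitz j; exists L => u v Ou Ov.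
    by rewrite (le_trans (HL _ _ Ou Ov))// ler_wpM2l// mdist_proj_le.
  rewrite (_ : _ `\` _ = set0) ?hausdorff0// AU.
  apply/seteqP; split => // p [[j _ [theta Ot tp]] nA].
  apply: nA; exists j => //; have [v [_ vt]] := torus_lift theta.
  by exists v => /=; rewrite vt.
- by apply: measurableT_comp => //; exact: measurable_funTS.
- by move=> x _ /=; exact: fine_ge0.
move=> B mB.
rewrite -HE setIC; transitivity (M (B `&` A)).
  apply: etrans (measureDI M mB mA) _.
  rewrite [X in X + _](A_null (measurableD mB mA)) ?add0e//.
  by rewrite setDE -setIA setICl setI0 hausdorff0.
transitivity (\int[nu]_(x in B `&` A) f x).
  by apply: fE; exact: measurableI.
rewrite (@eq_measure_integral _ _ _ (B `&` A) H); last first.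
  by move=> C mC CBA; rewrite /= /HA /mrestr setIidl// => x /CBA[].
by apply: eq_integral => x _; rewrite /= fineK.
Qed.

End rectifiable_graph.

Local Close Scope ereal_scope.

(** * Dimensions *)

Local Open Scope ereal_scope.

Lemma open_from_nbhs (X : topologicalType) (U : set X) :
  (forall x, U x -> nbhs x U) -> open U.
Proof. by rewrite openE. Qed.

Section ball_measure.
Variables (R : realType) (X : pmetricType R) (M : probability (borel X) R).
Implicit Types (x y : X) (e t : R).

Lemma ball_borel x e : measurable (ball x e : set (borel X)).
Proof. by rewrite ballEmdist; exact: mdist_ball_borel. Qed.

Lemma le_ball_measure x e e' : (e <= e')%R -> M (ball x e) <= M (ball x e').
Proof.
move=> ee'; apply: le_measure; rewrite ?inE; [exact: ball_borel..|].
by rewrite !ballEmdist => y /= /lt_le_trans; apply.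
Qed.

(** By continuity from below a slightly smaller ball already has mass above [t], and it is contained
    in the [e]-balls of all nearby points. *)
Lemma open_ball_measure_gt e (t : \bar R) : open [set x | t < M (ball x e)].
Proof.
apply: open_from_nbhs => x /= tx.
pose F n : set (borel X) := ball x (e - n.+1%:R^-1)%R.
have FU : \bigcup_n F n = ball x e.
  apply/seteqP; split=> [y [n _]|y]; rewrite /F !ballEmdist/=.
    by move/lt_le_trans; apply; rewrite gerBl invr_ge0.
  move=> xy; have d0 : (0 < e - mdist x y)%R by rewrite subr_gt0.
  exists (Num.truncn (e - mdist x y)^-1) => //; rewrite ballEmdist/=.
  by rewrite ltrBrDl -ltrBrDr invf_plt ?posrE// truncnS_gt.
have mF n : measurable (F n) by exact: ball_borel.
have FN : nondecreasing_seq F.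
  move=> n k nk; apply/subsetPset; rewrite /F !ballEmdist => y /=.
  by move/lt_le_trans; apply; rewrite lerD2l lerN2 lef_pV2 ?posrE// ler_nat.
have cvgF := nondecreasing_cvg_mu mF (bigcup_measurable (fun n _ => mF n)) FN.
have [n tn] : exists n, t < M (F n).
  apply/not_existsP => nt; move: tx; rewrite ltNge => /negP; apply.
  rewrite -FU -(cvg_lim _ (cvgF _ M))//; apply: lime_le.
    by apply/cvg_ex; eexists; exact: cvgF.
  by apply: nearW => n; rewrite leNgt; apply/negP; exact: nt.
apply/nbhs_ballP; exists n.+1%:R^-1%R => /=; first by rewrite invr_gt0.
move=> y; rewrite ballEmdist/= => xy; apply: (lt_le_trans tn).
apply: le_measure; rewrite ?inE; [exact: ball_borel..|].
rewrite /F !ballEmdist => z /= xz; rewrite (le_lt_trans (metric_triangle _ x _))//.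
by rewrite (metric_sym y) -ltrBrDl (lt_trans xz)// ltrD2l ltrN2.
Qed.

Lemma lne_gt (y : R) (p : \bar R) : (y%:E < lne p) = ((expR y)%:E < p).
Proof.
case: p => [r| |].
- rewrite lte_fin; have [r0|r0] := lerP r 0.
    rewrite le0_lneNy ?lee_fin// ltNge leNye/=; apply/esym/negbTE.
    by rewrite -leNgt (le_trans r0)// expR_ge0.
  by rewrite lne_EFin// lte_fin -[X in (X < _)%R]expRK ltr_ln ?posrE ?expR_gt0.
- by rewrite /= !ltry.
- by rewrite /= !ltNge !leNye.
Qed.

Lemma measurable_lne_ball e :
  measurable_fun setT (fun x : borel X => lne (M (ball (x : X) e))).
Proof.
apply: (@measurability _ _ (borel X) (\bar R) setT _ (@ErealGenOInfty.G R)).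
  exact: ErealGenOInfty.measurableE.
move=> _ [_ [r ->] <-]; rewrite setTI.
rewrite (_ : _ @^-1` _ = [set x | (expR r)%:E < M (ball x e)]).
  by apply: open_borel; exact: open_ball_measure_gt.
by apply/seteqP; split=> x /=; rewrite in_itv/= andbT lne_gt.
Qed.

Section cover.
Variables (S : set (borel X)) (fT : finType) (E : fT -> set X) (e : R).
Hypothesis mS : measurable S.
Hypothesis SE : S `<=` \bigcup_z E z.
Hypothesis Ee : forall z x y, E z x -> E z y -> (mdist x y < e / 2)%R.

(* Arbitrary cells are replaced by balls, which are measurable. *)
Let F z : set (borel X) :=
  if pselect (E z !=set0) is left h then ball (sval (cid h)) (e / 2) else set0.

Let mF z : measurable (F z).
Proof. by rewrite /F; case: pselect => // h; exact: ball_borel. Qed.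

Let SF x : S x -> exists z, F z x.
Proof.
move=> /SE[z _ Ex]; exists z; rewrite /F; case: pselect => [h|nE]; last first.
  by exfalso; apply: nE; exists x.
by rewrite ballEmdist/=; exact: Ee (svalP (cid h)) Ex.
Qed.

Let F_ball z x : F z x -> M (F z) <= M (ball x e).
Proof.
rewrite /F; case: pselect => // h; case: cid => /= c Ec; rewrite ballEmdist/= => cx.
apply: le_measure; rewrite ?inE; [exact: mdist_ball_borel|exact: ball_borel|].
rewrite ballEmdist => y /= cy; rewrite (le_lt_trans (metric_triangle _ c _))//.
by rewrite metric_sym [ltRHS]splitr ltrD.
Qed.

(** The cell of [x] lies inside its [e]-ball, so points with light balls are in light cells, at most
    [#|fT|] of them. *)
Lemma ball_measure_union_bound t : (0 <= t)%R ->
  M (S `&` [set x | M (ball x e) <= t%:E]) <= (#|fT|%:R * t)%:E.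
Proof.
move=> t0.
have mB : measurable (S `&` [set x | M (ball x e) <= t%:E]).
  apply: measurableI => //; rewrite (_ : [set _ | _] = ~` [set x | t%:E < M (ball x e)]).
    by apply: measurableC; apply: open_borel; exact: open_ball_measure_gt.
  by apply/seteqP; split => x /=; rewrite leNgt; move/negP.
pose F' z := if M (F z) <= t%:E then F z else set0.
have mF' z : measurable (F' z) by rewrite /F'; case: ifP.
apply: (@le_trans _ _ (M (\big[setU/set0]_(z <- enum fT) F' z))).
  apply: le_measure; rewrite ?inE//; first exact: bigsetU_measurable.
  move=> x [Sx xt]; have [z Fz] := SF Sx; rewrite -bigcup_seq; exists z.
    by rewrite /= mem_enum.
  by rewrite /F' (le_trans (F_ball Fz) xt).
rewrite cardE; elim: (enum fT) => [|z s IHs].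
  by rewrite big_nil measure0 mul0r.
rewrite big_cons; apply: (le_trans (measureU2 _ _ _)) => //.
  exact: bigsetU_measurable.
rewrite /= -natr1 mulrDl mul1r addrC EFinD leeD//.
by rewrite /F'; case: ifP; rewrite ?measure0.
Qed.

Lemma entropy_bound : (0 < #|fT|)%N ->
  \int[M]_(x in S) - lne (M (ball (x : X) e)) <=
  (1 + fine (M S) * ln #|fT|%:R)%:E.
Proof.
move=> n0; set n : R := #|fT|%:R.
have n1 : (1 <= n)%R by rewrite ler1n.
have n0' : (0 < n)%R by exact: lt_le_trans n1.
(* With [n] cells, [- ln q <= ln n + 1 / (n q)] is applied to the mass [q] of the
   cell of [x]; null cells get weight [+oo], contributing [+oo * 0 = 0]. *)
pose c z := if M (F z) == 0 then +oo else (fine (M (F z)))^-1%:E.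
have c0 z : 0 <= c z.
  by rewrite /c; case: ifP => // _; rewrite lee_fin invr_ge0 fine_ge0.
pose W z (x : borel X) := (cst (c z) \_ (F z)) x.
have W0 z x : 0 <= W z x by apply: erestrict_ge0 => ? _; exact: c0.
have mW z : measurable_fun setT (W z).
  by apply/(measurable_restrictT _ (mF z)); exact: measurable_cst.
have intW z : \int[M]_x W z x <= 1.
  have -> : \int[M]_x W z x = c z * M (F z).
    by rewrite /W -integral_mkcond integral_cst.
  rewrite /c; case: ifPn => [/eqP->|M0]; first by rewrite mule0.
  have Mfin : M (F z) \is a fin_num by rewrite fin_num_measure.
  by rewrite -{2}(fineK Mfin) -EFinM mulVf// fine_eq0.
have lnn0 : (0 <= ln n)%R by exact: ln_ge0.
have mlne D : measurable_fun D (fun x : borel X => - lne (M (ball (x : X) e))).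
  apply: measurableT_comp => //; apply: measurable_funTS.
  exact: measurable_lne_ball.
apply: (@le_trans _ _ (\int[M]_(x in S)
    ((ln n)%:E + n^-1%:E * \sum_(z <- enum fT) W z x))).
  apply: ge0_le_integral => //.
  - move=> x _; rewrite oppe_ge0 lne_le0 probability_le1//; exact: ball_borel.
  - apply: emeasurable_funD => //; apply: measurable_funeM.
    by apply: measurable_funTS; apply: emeasurable_sum.
  move=> x Sx; have [z Fz] := SF Sx.
  have le_W : W z x <= \sum_(z <- enum fT) W z x.
    rewrite (bigD1_seq z) ?mem_enum ?enum_uniq//= leeDl// sume_ge0//.
  apply: (@le_trans _ _ ((ln n)%:E + n^-1%:E * W z x)); last first.
    by rewrite leeD2l// lee_wpmul2l// lee_fin invr_ge0 ltW.
  rewrite /W patchE mem_set//= /c; case: ifPn => [M0|M0].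
    by rewrite gt0_muley ?lte_fin ?invr_gt0// addey ?leey.
  have Mfin : M (F z) \is a fin_num by rewrite fin_num_measure.
  set q := fine (M (F z)).
  have q0 : (0 < q)%R.
    by rewrite fine_gt0// lt0e M0 measure_ge0 -ge0_fin_numE ?measure_ge0.
  apply: (@le_trans _ _ (- (ln q)%:E)).
    rewrite leeN2 -lne_EFin//.
    rewrite lee_lne ?in_itv/= ?lee_fin ?(ltW q0) ?leey ?measure_ge0//.
    by rewrite /q fineK// F_ball.
  rewrite -EFinM -EFinD -EFinN lee_fin.
  have := ln_sublinear (_ : 0 < n^-1 * q^-1)%R.
  rewrite mulr_gt0 ?invr_gt0// => /(_ isT).
  rewrite lnM ?posrE ?invr_gt0// !lnV ?posrE//; lra.
have sumW0 x : 0 <= \sum_(z <- enum fT) W z x by exact: sume_ge0.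
have msumW : measurable_fun S (fun x => \sum_(z <- enum fT) W z x).
  by apply: measurable_funTS; exact: emeasurable_sum.
have ninv0 : 0 <= n^-1%:E by rewrite lee_fin invr_ge0 ltW.
rewrite (ge0_integralD _ mS)//; last 2 first.
- by move=> x _; rewrite mule_ge0.
- exact: measurable_funeM.
rewrite [X in X + _](_ : _ = (ln n)%:E * M S); last exact: integral_cst.
rewrite ge0_integralZl//.
have -> : (1 + fine (M S) * ln n)%:E = (ln n)%:E * M S + n^-1%:E * n%:E.
  rewrite -EFinM mulVf ?gt_eqF// addeC EFinD EFinM fineK 1?[X in _ + X]muleC//.
  exact: fin_num_measure.
apply: leeD => //; apply: lee_wpmul2l => //.
rewrite ge0_integral_sum//; last by move=> z; exact: measurable_funTS.
have WS z : \int[M]_(x in S) W z x <= 1.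
  apply: le_trans (intW z); apply: ge0_subset_integral => //.
apply: (@le_trans _ _ (\sum_(z <- enum fT) 1)); first by apply: lee_sum => z _.
by rewrite big_enum/= sumEFin sumr_const.
Qed.

End cover.
End ball_measure.

Lemma cvge_near_bounds (R : realType) (T : Type) (F : set_system T)
    (FF : ProperFilter F) (f : T -> \bar R) (d : R) :
  (forall eta : R, (0 < eta)%R ->
    \forall t \near F, (d - eta)%:E <= f t <= (d + eta)%:E) ->
  f t @[t --> F] --> d%:E.
Proof.
move=> H; apply/fine_cvgP; split.
  near=> t; have : (d - 1)%:E <= f t <= (d + 1)%:E by near: t; exact: H.
  move=> /andP[d1 d2]; rewrite fin_numElt (lt_le_trans _ d1) ?ltNyr//.
  by rewrite (le_lt_trans d2) ?ltry.
apply/cvgrPdist_le => eta eta0; near=> t.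
have : (d - eta)%:E <= f t <= (d + eta)%:E by near: t; exact: H.
move=> /=; case: (f t) => [r| |] /andP[] //=; rewrite !lee_fin ler_distlC => -> ->//.
Unshelve. all: by end_near. Qed.

Lemma near0_lnN_ge (R : realType) (A : R) :
  \forall e \near (0%R : R)^'+, [/\ (0 < e < 1)%R, (0 < - ln e)%R & (A <= - ln e)%R].
Proof.
near=> e.
have e0 : (0 < e)%R by near: e; exact: nbhs_right_gt.
have e1 : (e < 1)%R by near: e; exact: nbhs_right_lt.
have eA : (e < expR (- A))%R by near: e; apply: nbhs_right_lt; exact: expR_gt0.
split; [by rewrite e0|by rewrite oppr_gt0 ln_lt0// e0|].
by rewrite lerNr -(expRK (- A)%R) ler_ln ?posrE ?expR_gt0// ltW.
Unshelve. all: by end_near. Qed.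

Lemma measure_bigcup_null d (T : measurableType d) (R : realType)
    (mu : {measure set T -> \bar R}) (F : (set T)^nat) :
  (forall n, measurable (F n)) -> (forall n, mu (F n) = 0) ->
  mu (\bigcup_n F n) = 0.
Proof.
move=> mF F0; apply/eqP; rewrite eq_le measure_ge0 andbT.
apply: (@le_trans _ _ (\sum_(n <oo) mu (F n))).
  by apply: measure_sigma_subadditive => //; exact: bigcupT_measurable.
by rewrite eseries0.
Qed.

(** * From covering numbers to dimensions *)

Section dimension.
Variables (R : realType) (X : pmetricType R) (M : probability (borel X) R).
Variables (D : nat) (K : R).
Hypothesis K_ge1 : (1 <= K)%R.
Hypothesis M_ball : forall x (e : R), (0 < e)%R ->
  M (ball (x : X) e) <= ((K * e) ^+ D)%:E.

Definition coverable (S : set X) (e n : R) :=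
  exists (fT : finType) (E : fT -> set X),
    [/\ S `<=` \bigcup_z E z,
        forall z x y, E z x -> E z y -> (mdist x y < e / 2)%R,
        (0 < #|fT|)%N & (#|fT|%:R <= n)%R].

Variable S : nat -> set (borel X).
Hypothesis mS : forall j, measurable (S j).
Hypothesis S_cover : forall j, exists2 C : R, (1 <= C)%R &
  forall e : R, (0 < e < 1)%R -> coverable (S j) e (C / e ^+ D).
Hypothesis X_cover : exists2 C : R, (1 <= C)%R &
  forall e : R, (0 < e < 1)%R -> coverable setT e (C / e ^+ D.+1).
Hypothesis S_small : forall eta : R, (0 < eta)%R ->
  exists j, M (~` S j) <= eta%:E.

Let scale (n : nat) : R := expR (- n%:R).

(** This is [scale n] to the power [D + 1 / k.+1]. Against [O(scale n ^- D)] cells it leaves a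
    summable bound [exp (- n / k.+1)] for the measure of [thin]. *)
Let threshold (n k : nat) : R := expR (- (n%:R * (D%:R + k.+1%:R^-1))).

Let thin j k n : set (borel X) :=
  S j `&` [set x | M (ball (x : X) (scale n)) <= (threshold n k)%:E].

Let thin_borel j k n : measurable (thin j k n).
Proof.
apply: measurableI => //; rewrite (_ : [set _ | _] =
    ~` [set x | (threshold n k)%:E < M (ball (x : X) (scale n))]).
  by apply: measurableC; apply: open_borel; exact: open_ball_measure_gt.
by apply/seteqP; split => x /=; rewrite leNgt; move/negP.
Qed.

Let thin_null j k : M (lim_sup_set (thin j k)) = 0.
Proof.
have [C C1 HC] := S_cover j.
pose q : R := expR (- k.+1%:R^-1).
have q0 : (0 < q)%R by exact: expR_gt0.
have q1 : (q < 1)%R by rewrite expR_lt1 oppr_lt0 invr_gt0.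
have thin_le n : (0 < n)%N -> M (thin j k n) <= (C * q ^+ n)%:E.
  move=> n0; have e01 : (0 < scale n < 1)%R.
    by rewrite expR_gt0 expR_lt1 oppr_lt0 ltr0n.
  have [fT [E [SE Ee _ nC]]] := HC _ e01.
  have t0 : (0 <= threshold n k)%R by exact: expR_ge0.
  apply: (le_trans (ball_measure_union_bound M (mS j) SE Ee t0)).
  rewrite lee_fin; apply: (le_trans (ler_wpM2r t0 nC)).
  rewrite -mulrA ler_wpM2l ?(le_trans _ C1)// le_eqVlt; apply/orP; left; apply/eqP.
  rewrite /threshold /scale /q -!expRM_natl -expRN -expRD; congr expR.
  by rewrite mulrDr; ring.
apply: lim_sup_set_cvg0 => //.
(* The term [n = 0] is split off because the covering hypothesis needs [scale n < 1]. *)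
rewrite nneseries_recl//.
rewrite lte_add_pinfty//.
  by rewrite (le_lt_trans (probability_le1 M _))// ltry.
apply: (@le_lt_trans _ _ (C / (1 - q))%:E); last exact: ltry.
apply: lime_le; first by apply: is_cvg_nneseries => n _ _; exact: measure_ge0.
near=> n.
apply: (@le_trans _ _ (\sum_(1 <= i < n) (C * q ^+ i)%:E)).
  rewrite big_nat [leRHS]big_nat; apply: lee_sum => i /andP[i0 _]; exact: thin_le.
rewrite sumEFin lee_fin -mulr_sumr ler_wpM2l ?(le_trans _ C1)//.
apply: (@le_trans _ _ (\sum_(0 <= i < n) q ^+ i)%R).
  have n0 : (0 < n)%N by near: n; exact: nbhs_infty_gt.
  by rewrite [leRHS]big_ltn// lerDr expr0.
by apply: geometric_sum_le; rewrite (ltW q0) q1.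
Unshelve. all: by end_near. Qed.

Let lne_upper x (e : R) : (0 < e)%R ->
  (D%:R * (- ln e - ln K))%:E <= - lne (M (ball (x : X) e)).
Proof.
move=> e0; have K0 : (0 < K)%R by exact: lt_le_trans K_ge1.
have Ke0 : (0 < K * e)%R by rewrite mulr_gt0.
rewrite leeNr -EFinN.
have -> : (- (D%:R * (- ln e - ln K)))%R = ln ((K * e) ^+ D)%R.
  by rewrite lnXn// lnM ?posrE// -mulr_natl; ring.
rewrite -lne_EFin ?exprn_gt0// lee_lne ?in_itv/= ?leey ?measure_ge0 ?M_ball//.
by rewrite lee_fin exprn_ge0// ltW.
Qed.

Let pointwise x j : S j x -> (forall k, ~ lim_sup_set (thin j k) x) ->
  is_pointwise_dim M (x : X) D%:R%:E.
Proof.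
move=> Sx nthin; apply: cvge_near_bounds => eta eta0.
pose k := Num.truncn (2 / eta)%R.
have k_eta : (k.+1%:R^-1 <= eta / 2)%R.
  by rewrite invf_ple ?posrE ?divr_gt0// invf_div ltW// truncnS_gt.
have [n0 Hn0] : exists n0, forall n, (n0 <= n)%N ->
    (threshold n k)%:E < M (ball (x : X) (scale n)).
  apply: contrapT => H; apply: (nthin k) => n0 _.
  apply: contrapT => H'; apply: H; exists n0 => n n0n.
  rewrite ltNge; apply/negP => le_t; apply: H'; exists n => //.
(* With [l = - ln e], the three entries put the scale beyond [n0], absorb the constant [K] of the
   lower bound, and absorb the cost of rounding [l] up to the integer [n <= l + 1]. *)
pose A := (Num.max n0%:R
  (Num.max (D%:R * ln K / eta) (2 * (D%:R + k.+1%:R^-1) / eta)))%R.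
near=> e.
have [] : [/\ (0 < e < 1)%R, (0 < - ln e)%R & (A <= - ln e)%R].
  by near: e; exact: near0_lnN_ge.
move=> /andP[e0 e1] l0; rewrite !ge_max => /and3P[ln0 lK lD].
rewrite -muleNN -EFinN -invrN; set l := (- ln e)%R in l0 ln0 lK lD *.
pose n := (Num.truncn l).+1.
have ne : (scale n <= e)%R.
  rewrite /scale -[leRHS]lnK ?posrE// ler_expR lerNl -/l ltW//.
  exact: truncnS_gt.
have n0n : (n0 <= n)%N.
  by rewrite /n leqW// truncn_ge_nat ?(ltW l0).
have p_gt := lt_le_trans (Hn0 n n0n) (le_ball_measure M x ne).
have u_le : - lne (M (ball (x : X) e)) <= (n%:R * (D%:R + k.+1%:R^-1))%:E.
  rewrite leeNl -EFinN -[X in X%:E]expRK -lne_EFin ?expR_gt0//.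
  by rewrite lee_lne ?in_itv/= ?leey ?measure_ge0 ?lee_fin ?expR_ge0// ltW.
have nl : (n%:R <= l + 1)%R.
  by rewrite -natr1 lerD2r truncn_le// ltW.
have li0 : 0 <= (l^-1)%:E by rewrite lee_fin invr_ge0 ltW.
apply/andP; split.
  apply: le_trans (lee_wpmul2r li0 (lne_upper x e0)).
  rewrite -EFinM lee_fin ler_pdivlMr//.
  rewrite -/l; move: lK; rewrite ler_pdivrMr// => lK.
  by rewrite mulrBr; lra.
apply: (le_trans (lee_wpmul2r li0 u_le)).
rewrite -EFinM lee_fin ler_pdivrMr//.
move: lD; rewrite ler_pdivrMr// => lD.
set dl := k.+1%:R^-1%R in k_eta lD *.
have d0 : (0 <= D%:R + dl)%R by rewrite addr_ge0// invr_ge0.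
apply: (le_trans (ler_wpM2r d0 nl)).
have := ler_wpM2r (ltW l0) k_eta; lra.
Unshelve. all: by end_near. Qed.

Lemma exact_dimension : exists N : set (borel X),
  [/\ measurable N, M N = 0 &
      [set x | ~ is_pointwise_dim M (x : X) D%:R%:E] `<=` N].
Proof.
pose B : set (borel X) := \bigcup_j \bigcup_k lim_sup_set (thin j k).
have mL j k : measurable (lim_sup_set (thin j k)).
  apply: bigcapT_measurable => n; apply: bigcup_measurable => i _; exact: thin_borel.
have mB : measurable B.
  by apply: bigcupT_measurable => j; apply: bigcupT_measurable => k; exact: mL.
have mSU : measurable (\bigcup_j S j) by apply: bigcupT_measurable.
exists (~` (\bigcup_j S j) `|` B); split.
- by apply: measurableU => //; exact: measurableC.
- have S0 : M (~` \bigcup_j S j) = 0.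
    apply/eqP; rewrite eq_le measure_ge0 andbT; apply/lee_addgt0Pr => eta eta0.
    rewrite add0e; have [j Sj] := S_small eta0; apply: le_trans Sj.
    apply: le_measure; rewrite ?inE; [exact: measurableC..|].
    by apply: subsetC => x Sx; exists j.
  have B0 : M B = 0.
    apply: measure_bigcup_null => j; first by apply: bigcupT_measurable => k; exact: mL.
    by apply: measure_bigcup_null => k; [exact: mL|exact: thin_null].
  apply/eqP; rewrite eq_le measure_ge0 andbT.
  apply: (@le_trans _ _ (M (~` \bigcup_j S j) + M B)); last by rewrite S0 B0 adde0.
  by apply: measureU2 => //; exact: measurableC.
move=> x /= nx; apply: contrapT => /not_orP[/contrapT[j _ Sx] nB].
apply: nx; apply: (pointwise Sx) => k kx; apply: nB.
by exists j => //; exists k.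
Qed.

Let entropy_le (A : set (borel X)) (e C : R) (n : nat) : measurable A ->
  (1 <= C)%R -> (0 < e < 1)%R -> coverable A e (C / e ^+ n) ->
  \int[M]_(x in A) - lne (M (ball (x : X) e)) <=
    (1 + fine (M A) * (ln C + n%:R * (- ln e)))%:E.
Proof.
move=> mA' C1 /andP[e0 e1] [fT [E [AE Ee n0 nC]]].
apply: (le_trans (entropy_bound M mA' AE Ee n0)).
rewrite lee_fin lerD2l ler_wpM2l ?fine_ge0 ?measure_ge0//.
have C0 : (0 < C)%R by exact: lt_le_trans C1.
have -> : (ln C + n%:R * - ln e)%R = ln (C / e ^+ n)%R.
  by rewrite ln_div ?posrE ?exprn_gt0// lnXn// mulrN mulr_natl.
by rewrite ler_ln ?posrE ?divr_gt0 ?exprn_gt0// ltr0n.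
Qed.

Lemma information_dimension : is_information_dim M D%:R%:E.
Proof.
apply: cvge_near_bounds => eta eta0.
(* The rest of the space has entropy of order [D.+1 * l] times its mass; with mass at most [eta']
   this is [eta / 2 * l]. *)
pose eta' : R := (eta / 2 / D.+1%:R)%R.
have eta'0 : (0 < eta')%R by rewrite !divr_gt0.
have [j Sj] := S_small eta'0.
have [Cj Cj1 HCj] := S_cover j; have [C C1 HC] := X_cover.
pose c := (2 + ln Cj + ln C)%R.
(* The first entry keeps the lower bound non-negative, the second absorbs [K], the third the
   additive constants [c] of both entropy bounds. *)
pose A := (Num.max (ln K) (Num.max (D%:R * ln K / eta) (2 * c / eta)))%R.
near=> e.
have [] : [/\ (0 < e < 1)%R, (0 < - ln e)%R & (A <= - ln e)%R].
  by near: e; exact: near0_lnN_ge.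
move=> e01 l0; rewrite !ge_max => /and3P[lK lDK lc].
have /andP[e0 e1] := e01.
pose u (x : borel X) := - lne (M (ball (x : X) e)).
have u0 x : 0 <= u x.
  by rewrite oppe_ge0 lne_le0 probability_le1//; exact: ball_borel.
have mu_ : measurable_fun setT u.
  by apply: measurableT_comp => //; exact: measurable_lne_ball.
have -> : \int[M]_x lne (M (ball (x : X) e)) = - \int[M]_x u x.
  by rewrite -integral_ge0N//; apply: eq_integral => x _; rewrite oppeK.
rewrite -[(ln e)^-1%R]opprK EFinN muleNN -invrN.
set l := (- ln e)%R in l0 lK lDK lc *.
have li0 : 0 <= (l^-1)%:E by rewrite lee_fin invr_ge0 ltW.
have lower : (D%:R * (l - ln K))%:E <= \int[M]_x u x.
  have c0 : 0 <= (D%:R * (l - ln K))%:E by rewrite lee_fin mulr_ge0// subr_ge0.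
  apply: (@le_trans _ _ (\int[M]_x cst (D%:R * (l - ln K))%:E x)).
    by rewrite integral_cst// [X in _ * X]probability_setT mule1.
  apply: ge0_le_integral => // x _; exact: lne_upper.
have upper : \int[M]_x u x <= (c + D%:R * l + eta' * (D.+1%:R * l))%:E.
  rewrite -(setUv (S j)) ge0_integral_setU//; last 3 first.
  - exact: measurableC.
  - by rewrite setUv.
  - exact/disj_set2P/setICr.
  have h1 := entropy_le (mS j) Cj1 e01 (HCj e e01).
  have cov : coverable (~` S j) e (C / e ^+ D.+1).
    have [fT [E [TE Ee n0 nC]]] := HC e e01.
    by exists fT, E; split => // x _; exact: TE.
  have h2 := entropy_le (measurableC (mS j)) C1 e01 cov.
  apply: (le_trans (leeD h1 h2)); rewrite -EFinD lee_fin -/l.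
  have mfin B : measurable B -> M B \is a fin_num.
    by move=> mB; exact: fin_num_measure.
  have m1 : (fine (M (S j)) <= 1)%R.
    by rewrite -lee_fin fineK ?mfin// probability_le1.
  have m2 : (fine (M (~` S j)) <= 1)%R.
    by rewrite -lee_fin fineK ?mfin ?probability_le1//; exact: measurableC.
  have m2' : (fine (M (~` S j)) <= eta')%R.
    by rewrite -lee_fin fineK ?mfin//; exact: measurableC.
  have lnCj := ln_ge0 Cj1; have lnC := ln_ge0 C1.
  have Dl : (0 <= D%:R * l)%R by rewrite mulr_ge0// ltW.
  have Dl1 : (0 <= D.+1%:R * l)%R by rewrite mulr_ge0// ltW.
  have p1 := ler_wpM2r (addr_ge0 lnCj Dl) m1.
  have p2 := ler_wpM2r lnC m2; have p3 := ler_wpM2r Dl1 m2'.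
  rewrite /c; lra.
apply/andP; split.
  apply: le_trans (lee_wpmul2r li0 lower); rewrite -EFinM lee_fin ler_pdivlMr//.
  move: lDK; rewrite ler_pdivrMr// => lDK; rewrite mulrBr; lra.
apply: (le_trans (lee_wpmul2r li0 upper)); rewrite -EFinM lee_fin ler_pdivrMr//.
move: lc; rewrite ler_pdivrMr// => lc.
have -> : (eta' * (D.+1%:R * l))%R = (eta / 2 * l)%R by rewrite /eta' mulrA divfK.
lra.
Unshelve. all: by end_near. Qed.

End dimension.

Local Close Scope ereal_scope.

Section set_function_integral.
Import HBNNSimple.

(** The graph measure agrees with a measure only on Borel sets; that is enough because integrals of
    simple functions evaluate it only there. *)
Lemma eq_set_function_integral d (T : measurableType d) (R : realType)
    (mu1 mu2 : set T -> \bar R) (D : set T) (f : T -> \bar R) :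
  (forall A, measurable A -> mu1 A = mu2 A) ->
  (\int[mu1]_(x in D) f x = \int[mu2]_(x in D) f x)%E.
Proof.
move=> mu12.
have sE (h : {nnsfun T >-> R}) : sintegral mu1 h = sintegral mu2 h.
  by apply: eq_fsbigr => r _; rewrite mu12.
by rewrite /integral; congr (ereal_sup _ - ereal_sup _)%E;
  apply: eq_imagel => h _; exact: sE.
Qed.

End set_function_integral.

Lemma lipschitz_measurable_real (R : realType) (X : pmetricType R) (f : X -> R) :
  (forall x y, `|f x - f y| <= mdist x y) ->
  measurable_fun setT (f : borel X -> measurableTypeR R).
Proof.
move=> fL.
apply: (@measurability _ _ (borel X) (measurableTypeR R) setT f (@RGenOInfty.G R)).
  exact: RGenOInfty.measurableE.
move=> _ [_ [r ->] <-]; rewrite setTI; apply: open_borel.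
apply: open_from_nbhs => x /=; rewrite in_itv/= andbT => rx.
apply/nbhs_ballP; exists (f x - r) => /=; first by rewrite subr_gt0.
move=> y; rewrite ballEmdist/= in_itv/= andbT => xy.
have := le_lt_trans (le_trans (ler_norm _) (fL x y)) xy; lra.
Qed.

(** * Application to the graph measure *)

Section graph.
Variables (R : realType) (D : nat) (T : phase R D -> phase R D).
Variables (rho : 'rV[R]_D) (thetas : torus R D).
Hypothesis psp : pinched_skew_product T rho thetas.
Variables (alpha gamma L0 beta c d : R) (m : nat) (a b : R).
Hypothesis star : star_conditions T rho thetas alpha gamma L0 beta c d m a b.
Hypothesis D_gt0 : (0 < D)%N.
Variable P : probability (borel (torus R D)) R.
Hypothesis PE :
  forall B : set (borel (torus R D)), measurable B -> P B = lebesgue_torus B.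

Let G := graph_map T.
Let mG : measurable_fun setT (G : borel (torus R D) -> borel (phase R D)).
Proof. exact (measurable_graph_map psp star). Qed.

Let Omega j := good_base rho thetas m a b j.

Let a_gt1 : 1 < a. Proof. exact: star_a star. Qed.
Let b01 : 0 < b < 1. Proof. exact: star_b star. Qed.
Let m_gt0 : (0 < m)%N. Proof. exact: star_m star. Qed.

Let Omega_borel j : measurable (Omega j : set (borel (torus R D))).
Proof. exact: good_base_borel. Qed.

Let Omega_lipschitz j : exists2 L : R, 0 <= L &
  forall theta theta', Omega j theta -> Omega j theta' ->
  mdist (G theta) (G theta') <= L * mdist theta theta'.
Proof.
have [L L0' HL] := upper_bounding_graph_lipschitz psp star j.
exists (1 + L); first by rewrite addr_ge0.
move=> t t' Ot Ot'; rewrite [leLHS]/mdist/= /prod_dist ge_max/=.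
apply/andP; split; first by rewrite ler_peMl ?mdist_ge0// lerDl.
apply: (le_trans (clamp_lipschitz _ _)); apply: (le_trans (HL _ _ Ot Ot')).
by rewrite ler_wpM2r ?mdist_ge0// lerDr.
Qed.

Let P_ball (p : torus R D) (r : R) : 0 <= r ->
  (P [set q | (mdist p q < r)%R] <= ((6 * r) ^+ D)%:E)%E.
Proof. exact: torus_ball_le. Qed.

Let graph_borel : measurable ([set p | G p.1 = p] : set (borel (phase R D))).
Proof.
pose f (p : phase R D) := uval p.2.
have mf : measurable_fun setT (f : borel (phase R D) -> measurableTypeR R).
  apply: lipschitz_measurable_real => p q.
  by rewrite [leRHS]/mdist/= /prod_dist le_max; apply/orP; right; exact: lexx.
have mg : measurable_fun setT
    ((f \o (G \o fst)) : borel (phase R D) -> measurableTypeR R).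
  by apply: measurableT_comp mf _; exact: measurableT_comp mG (@measurable_fst_phase R D).
have mfg := measurable_funB mg mf.
rewrite (_ : [set p | _] = ((f \o (G \o fst)) \- f) @^-1` [set 0]).
  by rewrite -[X in measurable X]setTI; apply: mfg => //; exact: measurable_set1.
apply/seteqP; split => p /=; rewrite /f.
  by move=> Gp; apply/eqP; rewrite subr_eq0; apply/eqP; exact: (congr1 f Gp).
move=> /subr0_eq h; rewrite [RHS]surjective_pairing; congr pair.
by apply/val_inj.
Qed.

Let GM : {mfun borel (torus R D) >-> borel (phase R D)} :=
  HB.pack (G : borel (torus R D) -> borel (phase R D))
    (isMeasurableFun.Build _ _ _ _ _ mG).

Let M := distribution P GM.

Let mu := graph_measure (upper_bounding_graph T).

Let muE (B : set (borel (phase R D))) : measurable B -> mu B = M B.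
Proof.
move=> mB; rewrite /mu (graph_measureE psp star) /M /distribution /pushforward.
by rewrite PE// -[X in measurable X]setTI; exact: mG.
Qed.

Lemma graph_measure_rectifiable : rectifiable_measure D mu.
Proof.
split; first by exists M => B /muE.
have [A [f [rA mf f0 fE]]] := graph_rectifiable (G := G) D_gt0 P_ball
  (fun p => torus_set1_null D_gt0 PE p) (fun=> erefl) mG graph_borel Omega_borel
  Omega_lipschitz (full_base_null D_gt0 rho thetas m_gt0 a_gt1 b01 PE).
by exists A, f; split => // B mB; rewrite (muE mB) -fE.
Qed.

Let M_ball x (e : R) : 0 < e -> (M (ball (x : phase R D) e) <= ((6 * e) ^+ D)%:E)%E.
Proof.
move=> e0; apply: le_trans (P_ball x.1 (ltW e0)).
change (P (G @^-1` ball x e) <= P [set q | (mdist x.1 q < e)%R])%E.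
apply: le_measure; rewrite ?inE.
- by rewrite -[X in measurable X]setTI; apply: mG => //; exact: ball_borel.
- exact: mdist_ball_borel.
move=> theta /=; rewrite ballEmdist/=; apply: le_lt_trans.
exact: (mdist_fst_le x (G theta)).
Qed.

Let S j : set (borel (phase R D)) := [set p | G p.1 = p] `&` fst @^-1` Omega j.

Let mS j : measurable (S j).
Proof.
apply: measurableI => //; rewrite -[X in measurable X]setTI.
exact: measurable_fst_phase.
Qed.

Let grid_bound (k e : R) : 0 <= k -> 0 < e < 1 ->
  (Num.truncn (2 * k / e)).+1%:R <= (2 * k + 1) / e.
Proof.
move=> k0 /andP[e0 e1].
rewrite -natr1 [leRHS]mulrDl lerD//.
  by rewrite truncn_le// divr_ge0 ?mulr_ge0// ltW.
by rewrite mul1r invf_ge1// ltW.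
Qed.

Let grid_fine (k e : R) : 0 < e -> k / (Num.truncn (2 * k / e)).+1%:R < e / 2.
Proof.
move=> e0; rewrite ltr_pdivrMr// -ltr_pdivrMl ?divr_gt0// invf_div mulrAC.
exact: truncnS_gt.
Qed.

Let S_cover j : exists2 C : R, 1 <= C &
  forall e : R, 0 < e < 1 -> coverable (S j) e (C / e ^+ D).
Proof.
have [L L0' HL] := Omega_lipschitz j.
have k0 : 0 <= L * D%:R by rewrite mulr_ge0.
exists ((2 * (L * D%:R) + 1) ^+ D); first by rewrite exprn_ege1// lerDr mulr_ge0.
move=> e e01; have /andP[e0 e1] := e01.
set N := Num.truncn (2 * (L * D%:R) / e).
exists {ffun 'I_D -> 'I_N.+1}, (fun z => G @` (Omega j `&` torus_cell z)); split.
- move=> p [/= Gp Op]; have [z zp] := torus_cell_cover N p.1.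
  by exists z => //; exists p.1.
- move=> z _ _ [t [Ot zt] <-] [t' [Ot' zt'] <-].
  apply: (le_lt_trans (HL _ _ Ot Ot')).
  apply: (le_lt_trans (ler_wpM2l L0' (torus_cell_mdist zt zt'))).
  by rewrite mulrA grid_fine.
- by rewrite card_ffun !card_ord expn_gt0.
- rewrite card_ffun !card_ord natrX -expr_div_n.
  by rewrite lerXn2r ?nnegrE ?divr_ge0 ?addr_ge0 ?mulr_ge0 ?(ltW e0)// grid_bound.
Qed.

Let X_cover : exists2 C : R, 1 <= C &
  forall e : R, 0 < e < 1 -> coverable (setT : set (phase R D)) e (C / e ^+ D.+1).
Proof.
exists (2 * (2 * D%:R + 1) ^+ D.+1).
  by rewrite mulr_ege1// ?ler1n// exprn_ege1// lerDr mulr_ge0.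
move=> e e01; have /andP[e0 e1] := e01.
set N := Num.truncn (2 * D%:R / e).
pose cell (x : R) := Num.truncn (x * N.+1%:R).
(* Height 1 falls into cell [N.+1], so there are [N.+2] vertical cells; the leading factor 2 of the
   constant comes from [N.+2 <= 2 * N.+1]. *)
pose E (zk : ({ffun 'I_D -> 'I_N.+1} * 'I_N.+2)%type) : set (phase R D) :=
  [set p | torus_cell zk.1 p.1 /\ cell (uval p.2) = nat_of_ord zk.2].
exists ({ffun 'I_D -> 'I_N.+1} * 'I_N.+2)%type, E; split.
- move=> p _; have [z zp] := torus_cell_cover N p.1.
  have /andP[x0 x1] := uval_itv p.2.
  have lt : (cell (uval p.2) < N.+2)%N.
    rewrite ltnS -(ler_nat R); apply: (@le_trans _ _ (uval p.2 * N.+1%:R)).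
      by rewrite truncn_le mulr_ge0.
    by rewrite ler_piMl.
  by exists (z, Ordinal lt).
- move=> [z k] p q [/= zp kp] [zq kq].
  rewrite [ltLHS]/mdist/= /prod_dist gt_max; apply/andP; split.
    by apply: (le_lt_trans (torus_cell_mdist zp zq)); exact: grid_fine.
  apply: le_lt_trans (grid_fine D%:R e0).
  have /andP[p0 _] := uval_itv p.2; have /andP[q0 _] := uval_itv q.2.
  rewrite [leLHS]/mdist/= /unit_interval_dist -/N.
  have N0 : 0 < N.+1%:R :> R by [].
  rewrite ler_pdivlMr//; apply: (@le_trans _ _ 1); last by rewrite ler1n.
  have -> : `|uval p.2 - uval q.2| * N.+1%:R =
      `|uval p.2 * N.+1%:R - uval q.2 * N.+1%:R|.
    by rewrite -mulrBl normrM (gtr0_norm N0).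
  have := truncn_itv (mulr_ge0 p0 (ltW N0)).
  have := truncn_itv (mulr_ge0 q0 (ltW N0)).
  rewrite -/(cell _) -/(cell (uval p.2)) kp kq -natr1 ler_norml.
  by move=> /andP[? ?] /andP[? ?]; apply/andP; split; lra.
- by rewrite card_prod card_ffun !card_ord muln_gt0 expn_gt0.
- rewrite card_prod card_ffun !card_ord natrM natrX.
  have gb := grid_bound (ler0n R D) e01; rewrite -/N in gb.
  apply: (@le_trans _ _ (2 * N.+1%:R ^+ D.+1)).
    rewrite exprSr mulrCA ler_wpM2l ?exprn_ge0// -natrM ler_nat; lia.
  rewrite -mulrA ler_wpM2l// -expr_div_n.
  by rewrite lerXn2r ?nnegrE ?divr_ge0 ?addr_ge0 ?mulr_ge0 ?(ltW e0).
Qed.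

Let S_small (eta : R) : 0 < eta -> exists j, (M (~` S j) <= eta%:E)%E.
Proof.
move=> eta0; have [j Hj] := good_base_small D_gt0 rho thetas m_gt0 a_gt1 b01 PE eta0.
exists j; apply: le_trans Hj.
change (P (G @^-1` ~` S j) <= P (~` Omega j))%E; apply: le_measure; rewrite ?inE.
- by rewrite -[X in measurable X]setTI; apply: mG => //; exact: measurableC.
- by apply: measurableC; exact: Omega_borel.
by move=> theta /= nS Ot; apply: nS.
Qed.

Lemma graph_measure_exact_dim : is_exact_dim mu D%:R%:E.
Proof.
have [N [mN N0 HN]] := exact_dimension (ler1n R 6) M_ball mS S_cover S_small.
exists N; split => //; first by rewrite (muE mN).
move=> x /= nx; apply: HN => /= h; apply: nx; rewrite /is_pointwise_dim.
rewrite (_ : (fun e => _) = (fun e => lne (M (ball x e)) * (ln e)^-1%:E)%E)//.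
by apply/funext => e; rewrite muE//; exact: ball_borel.
Qed.

Lemma graph_measure_information_dim : is_information_dim mu D%:R%:E.
Proof.
have := information_dimension (ler1n R 6) M_ball mS S_cover X_cover S_small.
rewrite /is_information_dim; apply: cvg_trans.
apply: near_eq_cvg; near=> e.
rewrite (eq_set_function_integral _ _ muE); congr (_ * _)%E.
by apply: eq_integral => x _; rewrite muE//; exact: ball_borel.
Unshelve. all: by end_near. Qed.

End graph.

Theorem theorem5p5 (R : realType) (D : nat) (D_gt0 : (0 < D)%N)
    (T : phase R D -> phase R D) (hT : class_T_star T) :
  let mu := graph_measure (upper_bounding_graph T) in
  [/\ rectifiable_measure D mu,
      is_exact_dim mu (D%:R)%:E &
      is_information_dim mu (D%:R)%:E].
Proof.
have [rho [thetas [psp [alpha [gamma [L0 [beta [c [d [m [a [b star]]]]]]]]]]]] := hT.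
have [P PE] := torus_probability R D.
split.
- exact (graph_measure_rectifiable psp star D_gt0 PE).
- exact (graph_measure_exact_dim psp star D_gt0 PE).
- exact (graph_measure_information_dim psp star D_gt0 PE).
Qed.
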